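(* A Schur-class function $S\in{\mathcal S}_d({\mathcal U},{\mathcal Y})$ admits a contractive commutative realization $S(\lambda)=D+C(I-Z(\lambda)A)^{-1}Z(\lambda)B$ with ${\mathbf A}=(A_1,\dots,A_d)$ strongly stable and $(C,{\mathbf A})$ isometric if and only if there exist a Hilbert space ${\mathcal F}$ and a function $\widetilde S$ such that $\widehat S(\lambda)=\begin{bmatrix}S(\lambda)&\widetilde S(\lambda)\end{bmatrix}\in{\mathcal S}_d({\mathcal U}\oplus{\mathcal F},{\mathcal Y})$ is an inner multiplier.
   Context: Let ${\mathbb B}^d=\{\lambda\in{\mathbb C}^d:\langle\lambda,\lambda\rangle<1\}$. ${\mathcal H}_{\mathcal Y}(k_d)$ is the reproducing kernel Hilbert space of ${\mathcal Y}$-valued functions on ${\mathbb B}^d$ with kernel $k_d(\lambda,\zeta)I_{\mathcal Y}$, $k_d(\lambda,\zeta)=1/(1-\langle\lambda,\zeta\rangle)$. ${\mathcal S}_d({\mathcal U},{\mathcal Y})$ is the set of ${\mathcal L}({\mathcal U},{\mathcal Y})$-valued holomorphic $S$ on ${\mathbb B}^d$ such that $M_S:f\mapsto Sf$ is a contraction from ${\mathcal H}_{\mathcal U}(k_d)$ into ${\mathcal H}_{\mathcal Y}(k_d)$; it is an inner multiplier if $M_S$ is a partial isometry. A realization: Hilbert space ${\mathcal X}$, $A_j\in{\mathcal L}({\mathcal X})$, $B_j\in{\mathcal L}({\mathcal U},{\mathcal X})$, $C\in{\mathcal L}({\mathcal X},{\mathcal Y})$, $D\in{\mathcal L}({\mathcal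 U},{\mathcal Y})$, $A=\mathrm{col}(A_j)$, $B=\mathrm{col}(B_j)$, $Z(\lambda)=[\lambda_1I\ \cdots\ \lambda_dI]$, with $S(\lambda)=D+C(I-Z(\lambda)A)^{-1}Z(\lambda)B$; contractive if ${\mathbf U}=\begin{bmatrix}A&B\\C&D\end{bmatrix}$ is a contraction; commutative if the $A_j$ pairwise commute. $(C,{\mathbf A})$ is isometric if $\sum_jA_j^*A_j+C^*C=I$. ${\mathbf A}$ strongly stable: $\lim_{N\to\infty}\sum_{|n|=N}\frac{N!}{n!}\|A_1^{n_1}\cdots A_d^{n_d}x\|^2=0$ for every $x$. *)

(* Defs.v *)
From HB Require Import structures.
From mathcomp Require Import all_boot all_order all_algebra.
From mathcomp Require Import complex reals.
Set Implicit Arguments. Unset Strict Implicit. Unset Printing Implicit Defensive.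
Import Order.TTheory GRing.Theory Num.Theory.
Local Open Scope ring_scope.
Local Open Scope complex_scope.

Section PreHilbert.
Variable R : realType.
Local Notation C := R[i].
Variable V : lmodType C.
(* [ip] is an inner product on V (linear in the first variable). *)
Variable ip : V -> V -> C.

Definition ipnorm (x : V) : R := Num.sqrt (complex.Re (ip x x)).

Definition vconv (u : nat -> V) (l : V) : Prop :=
  forall e : R, 0 < e -> exists M, forall m, (M <= m)%N -> ipnorm (u m - l) < e.
Definition vcauchy (u : nat -> V) : Prop :=
  forall e : R, 0 < e -> exists M, forall m n, (M <= m)%N -> (M <= n)%N ->
    ipnorm (u m - u n) < e.
End PreHilbert.

Definition rconv (R : realType) (u : nat -> R) (l : R) : Prop :=
  forall e : R, 0 < e -> exists M, forall m, (M <= m)%N -> `|u m - l| < e.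
Definition cconv (R : realType) (u : nat -> R[i]) (l : R[i]) : Prop :=
  forall e : R, 0 < e -> exists M, forall m, (M <= m)%N -> `|u m - l| < e%:C.

HB.mixin Record Lmodule_isHilbert (R : realType) V of GRing.Lmodule R[i] V := {
  inner : V -> V -> R[i];
  innerDl : forall (a : R[i]) (x y z : V),
      inner (a *: x + y) z = a * inner x z + inner y z;
  innerC : forall x y, inner y x = (inner x y)^*;
  inner_ge0 : forall x, 0 <= inner x x;
  inner_eq0 : forall x, inner x x = 0 -> x = 0;
  inner_complete : forall u : nat -> V,
      vcauchy inner u -> exists l, vconv inner u l
}.

#[short(type="hilbType")]
HB.structure Definition Hilbert (R : realType) :=
  {V of Lmodule_isHilbert R V & GRing.Lmodule R[i] V}.

Section Operators.
Variable R : realType.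
Local Notation C := R[i].

Definition lin (V W : lmodType C) (T : V -> W) : Prop :=
  forall (a : C) (x y : V), T (a *: x + y) = a *: T x + T y.

Definition bounded (V W : lmodType C) (ipV : V -> V -> C) (ipW : W -> W -> C)
  (T : V -> W) : Prop :=
  exists M : R, forall x, ipnorm ipW (T x) <= M * ipnorm ipV x.

Definition is_adjoint (V W : lmodType C) (ipV : V -> V -> C) (ipW : W -> W -> C)
  (T : V -> W) (Ts : W -> V) : Prop :=
  forall x y, ipW (T x) y = ipV x (Ts y).

Definition ip_sum (V W : lmodType C) (ipV : V -> V -> C) (ipW : W -> W -> C)
  (p q : V * W) : C := ipV p.1 q.1 + ipW p.2 q.2.
End Operators.

Section DruryArveson.
Variable R : realType.
Local Notation C := R[i].
Variable d : nat.

Definition cinner (l z : 'I_d -> C) : C := \sum_(j < d) l j * (z j)^*.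
Definition inball (l : 'I_d -> C) : Prop := cinner l l < 1.

Definition mdeg (n : {ffun 'I_d -> nat}) : nat := \sum_(j < d) n j.
Definition mfact (n : {ffun 'I_d -> nat}) : nat := \prod_(j < d) (n j)`!.
Definition mono (l : 'I_d -> C) (n : {ffun 'I_d -> nat}) : C :=
  \prod_(j < d) l j ^+ n j.
Definition mi_of (N : nat) (m : {ffun 'I_d -> 'I_N.+1}) : {ffun 'I_d -> nat} :=
  [ffun j => nat_of_ord (m j)].
Definition level (N : nat) : seq {ffun 'I_d -> nat} :=
  [seq mi_of m | m <- enum {: {ffun 'I_d -> 'I_N.+1}} & mdeg (mi_of m) == N].

Variable V : lmodType C.
Variable ip : V -> V -> C.

Definition taylor (c : {ffun 'I_d -> nat} -> V) (f : ('I_d -> C) -> V) : Prop :=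
  forall l, inball l ->
    vconv ip (fun M => \sum_(N < M) \sum_(n <- level N) mono l n *: c n) (f l).

(* partial sums of the Drury-Arveson norm / inner product of H_V(k_d):
   ||f||^2 = sum_n (n!/|n|!) ||f_n||^2 *)
Definition DAsq (c : {ffun 'I_d -> nat} -> V) (M : nat) : R :=
  \sum_(N < M) \sum_(n <- level N) ((mfact n)%:R / (N`!)%:R) * ipnorm ip (c n) ^+ 2.
Definition DAip (c c' : {ffun 'I_d -> nat} -> V) (M : nat) : C :=
  \sum_(N < M) \sum_(n <- level N) ((mfact n)%:R / (N`!)%:R) * ip (c n) (c' n).

Definition inDA (f : ('I_d -> C) -> V) (c : {ffun 'I_d -> nat} -> V) (L : R) :
  Prop := taylor c f /\ rconv (DAsq c) L.

End DruryArveson.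

Section Multipliers.
Variable R : realType.
Local Notation C := R[i].
Variable d : nat.
Variable V : lmodType C.
Variable ip : V -> V -> C.
Variable W : lmodType C.
Variable ipW : W -> W -> C.

Definition mult_contractive (S : ('I_d -> C) -> V -> W) : Prop :=
  forall f c L, inDA ip f c L ->
    exists g L', inDA ipW (fun l => S l (f l)) g L' /\ L' <= L.

(* M_S is a partial isometry: isometric on the orthogonal complement of its
   kernel *)
Definition mult_partial_isometry (S : ('I_d -> C) -> V -> W) : Prop :=
  forall f c L, inDA ip f c L ->
    (forall f' c' L', inDA ip f' c' L' ->
       (forall l, inball l -> S l (f' l) = 0) -> cconv (DAip ip c c') 0) ->
    exists g, inDA ipW (fun l => S l (f l)) g L.

Definition schur (S : ('I_d -> C) -> V -> W) : Prop :=
  (forall l, inball l -> lin (S l) /\ bounded ip ipW (S l)) /\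
  mult_contractive S.

Definition inner_multiplier (S : ('I_d -> C) -> V -> W) : Prop :=
  schur S /\ mult_partial_isometry S.
End Multipliers.

Section Realization.
Variable R : realType.
Local Notation C := R[i].
Variable d : nat.
Variables (U Y X : hilbType R).
Variables (A : 'I_d -> X -> X) (B : 'I_d -> U -> X) (Cc : X -> Y) (D : U -> Y).

(* S(lambda) = D + C (I - Z(lambda) A)^{-1} Z(lambda) B, i.e. S(lambda) u =
   D u + C x where x solves (I - Z(lambda)A) x = Z(lambda) B u *)
Definition realizes (S : ('I_d -> C) -> U -> Y) : Prop :=
  forall l, inball l -> forall u,
    exists x : X, x - \sum_(j < d) l j *: A j x = \sum_(j < d) l j *: B j u /\
                  S l u = D u + Cc x.

(* the colligation U = [A B; C D] : X (+) U -> X^d (+) Y is a linear contraction *)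
Definition contractive_colligation : Prop :=
  (forall j, lin (A j)) /\ (forall j, lin (B j)) /\ lin Cc /\ lin D /\
  forall (x : X) (u : U),
    \sum_(j < d) ipnorm inner (A j x + B j u) ^+ 2 + ipnorm inner (Cc x + D u) ^+ 2
    <= ipnorm inner x ^+ 2 + ipnorm inner u ^+ 2.

Definition commutative_tuple : Prop :=
  forall i j x, A i (A j x) = A j (A i x).

Definition isometric_pair : Prop :=
  exists (As : 'I_d -> X -> X) (Cs : Y -> X),
    (forall j, is_adjoint inner inner (A j) (As j)) /\ is_adjoint inner inner Cc Cs /\
    forall x, \sum_(j < d) As j (A j x) + Cs (Cc x) = x.

Definition Apow (n : {ffun 'I_d -> nat}) (x : X) : X :=
  foldr (fun j y => iter (n j) (A j) y) x (enum 'I_d).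

Definition strongly_stable : Prop :=
  forall x : X, rconv (fun N => \sum_(n <- level d N)
      ((N`!)%:R / (mfact n)%:R) * ipnorm inner (Apow n x) ^+ 2) 0.
End Realization.

(* Main.v *)
Require Import Defs.
From HB Require Import structures.
From mathcomp Require Import all_boot all_order all_algebra.
From mathcomp Require Import boolp classical_sets functions complex reals ring lra.
Import Order.TTheory GRing.Theory Num.Theory.
Local Open Scope ring_scope.
Set Implicit Arguments. Unset Strict Implicit. Unset Printing Implicit Defensive.

(** Everything is done on Taylor coefficients, without kernels.

    From a realization to an inner multiplier: since [A B; C D] is a contraction, adjoining
    its defect operator (I - T T* )^(1/2) as extra input columns makes it coisometric and
    defines the completion [S St].  Feeding the extended system with an input f and an
    initial state x gives an output M f + O x, and the energy balance (the row of
    coordinate multiplications is a contraction on the Drury-Arveson space) shows that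
    [M O] is a contraction.  Running the adjoint system backwards on polynomials shows
    that [M O] is coisometric.  Strong stability makes the observability operator O an
    isometry, so M and O have orthogonal ranges and M is a partial isometry.

    From an inner multiplier to a realization: let M be multiplication by [S St], let
    X = (ran M)^perp, A_j = the backward shifts restricted to X and C = evaluation at 0.
    The columns B and D come from a factorization of M on constants through
    X^d + Y, i.e. from the bound |(M* h)_0| <= |(P_X M_j* h)_j, h_0|.  It holds because
    sum_j |M_j* h|^2 = |h|^2 - |h_0|^2, the M_j* commute with M*, and
    |P_X g|^2 = |g|^2 - |M* g|^2 as M is a partial isometry. *)

(** For d > 1 the row of coordinate multiplications is not isometric, because a multi-index may have
    several predecessors. A forward run can therefore lose energy even for an isometric colligation
    ([lev_row]), whereas the column of backward shifts loses only the constant term ([lev_bshift],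
    [sqn_bshift]). An exact balance is thus available for the adjoint system only; since that system
    descends from infinite degree, it is started from the zero state above a polynomial, and
    truncation carries the result to all outputs. Both facts rest on one identity: the weight ratios
    (n_j+1)/(N+1) over the predecessors of a multi-index of degree N+1 sum to 1. In the converse
    direction, the backward shifts of M e, for e constant, are not obvious candidates for the B_j:
    the pairing of the j-th one with M c is the pairing of M e with M (z_j c), which vanishes if M
    is isometric but has no reason to vanish when M has a kernel. Hence B and D are obtained by
    duality, from a bound on the adjoint side. *)

(** * Real and imaginary parts and squared moduli of complex numbers *)

Section ComplexFacts.
Variable R : realType.
Implicit Types z w : R[i].

Definition csq z : R := complex.Re z ^+ 2 + complex.Im z ^+ 2.

Lemma csq_ge0 z : 0 <= csq z.
Proof. by rewrite addr_ge0 ?sqr_ge0. Qed.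

Lemma csqM z w : csq (z * w) = csq z * csq w.
Proof. by case: z w => [a b] [c e]; rewrite /csq /=; ring. Qed.

Lemma csq1 : csq 1 = 1.
Proof. by rewrite /csq /= expr0n expr1n addr0. Qed.

Lemma csq_real (a : R) : csq a%:C%C = a ^+ 2.
Proof. by rewrite /csq /= expr0n addr0. Qed.

Lemma mulc_conj z : z * z^*%C = (csq z)%:C%C.
Proof.
case: z => a b; apply/eqP; rewrite eq_complex /csq /=.
by apply/andP; split; apply/eqP; ring.
Qed.

Lemma conjcD z w : (z + w)^*%C = z^*%C + w^*%C.
Proof. exact: rmorphD. Qed.
Lemma conjcM z w : (z * w)^*%C = z^*%C * w^*%C.
Proof. exact: rmorphM. Qed.
Lemma conjcN z : (- z)^*%C = - z^*%C.
Proof. exact: rmorphN. Qed.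

Lemma ReD z w : complex.Re (z + w) = complex.Re z + complex.Re w.
Proof. by case: z w => [a b] [c e]. Qed.
Lemma ImD z w : complex.Im (z + w) = complex.Im z + complex.Im w.
Proof. by case: z w => [a b] [c e]. Qed.
Lemma ReN z : complex.Re (- z) = - complex.Re z.
Proof. by case: z. Qed.
Lemma ImN z : complex.Im (- z) = - complex.Im z.
Proof. by case: z. Qed.
Lemma ReZ (a : R) z : complex.Re (a%:C%C * z) = a * complex.Re z.
Proof. by case: z => b c /=; ring. Qed.
Lemma ImZ (a : R) z : complex.Im (a%:C%C * z) = a * complex.Im z.
Proof. by case: z => b c /=; ring. Qed.
Lemma Re_conj z : complex.Re z^*%C = complex.Re z.
Proof. by case: z. Qed.
Lemma Im_conj z : complex.Im z^*%C = - complex.Im z.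
Proof. by case: z. Qed.
Lemma Re_sum (I : Type) (s : seq I) (F : I -> R[i]) :
  complex.Re (\sum_(i <- s) F i) = \sum_(i <- s) complex.Re (F i).
Proof. by elim: s => [|i s IH]; rewrite ?big_nil // !big_cons ReD IH. Qed.
Lemma Im_sum (I : Type) (s : seq I) (F : I -> R[i]) :
  complex.Im (\sum_(i <- s) F i) = \sum_(i <- s) complex.Im (F i).
Proof. by elim: s => [|i s IH]; rewrite ?big_nil // !big_cons ImD IH. Qed.

Lemma complex_eqP z w :
  complex.Re z = complex.Re w -> complex.Im z = complex.Im w -> z = w.
Proof. by case: z w => [a b] [c e] /= -> ->. Qed.

Lemma natCr n : (n%:R : R[i]) = (n%:R : R)%:C%C.
Proof. by rewrite raddfMn. Qed.

Lemma natCV n : (n%:R : R[i])^-1 = ((n%:R : R)^-1)%:C%C.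
Proof. by rewrite natCr fmorphV. Qed.

Lemma normc_lt z (e : R) : 0 < e -> (`|z| < e%:C%C) = (csq z < e ^+ 2).
Proof.
move=> e0; rewrite normc_def ltcR -[X in _ < X](ger0_norm (ltW e0)) -sqrtr_sqr.
by rewrite ltr_sqrt // exprn_gt0.
Qed.

End ComplexFacts.

(** * Limits of real sequences and monotone convergence *)

Section RealLimits.
Variable R : realType.
Implicit Types (u v : nat -> R) (l : R).

Lemma rconv_cst l : rconv (fun=> l) l.
Proof. by move=> e e0; exists 0%N => m _; rewrite subrr normr0. Qed.

Lemma rconvD u v l m : rconv u l -> rconv v m -> rconv (fun n => u n + v n) (l + m).
Proof.
move=> cu cv e e0; have e2 : 0 < e / 2 by rewrite divr_gt0.
have [M HM] := cu _ e2; have [N HN] := cv _ e2.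
exists (maxn M N) => n; rewrite geq_max => /andP[/HM h1 /HN h2].
rewrite opprD addrACA; apply: (le_lt_trans (ler_normD _ _)).
by rewrite [e]splitr ltrD.
Qed.

Lemma rconvZ a u l : rconv u l -> rconv (fun n => a * u n) (a * l).
Proof.
move=> cu e e0; have a0 : 0 < `|a| + 1 by rewrite ltr_wpDl.
have [M HM] := cu _ (divr_gt0 e0 a0); exists M => n /HM h.
rewrite -mulrBr normrM; move: h; rewrite ltr_pdivlMr // => h.
apply: le_lt_trans h; rewrite mulrC ler_wpM2l ?normr_ge0 //.
by rewrite lerDl.
Qed.

Lemma rconvN u l : rconv u l -> rconv (fun n => - u n) (- l).
Proof.
move=> cu e /cu [M HM]; exists M => n /HM h.
by rewrite -opprD normrN.
Qed.

Lemma rconvB u v l m : rconv u l -> rconv v m -> rconv (fun n => u n - v n) (l - m).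
Proof. by move=> cu /rconvN; exact: rconvD. Qed.

Lemma rconv_ext u v l : u =1 v -> rconv u l -> rconv v l.
Proof. by move=> uv cu e /cu [M HM]; exists M => n /HM; rewrite uv. Qed.

Lemma rconv_sum (I : Type) (s : seq I) (u : I -> nat -> R) (l : I -> R) :
  (forall i, rconv (u i) (l i)) ->
  rconv (fun n => \sum_(i <- s) u i n) (\sum_(i <- s) l i).
Proof.
move=> cu; elim: s => [|i s IH].
  by rewrite big_nil; apply: rconv_ext (rconv_cst 0) => n; rewrite big_nil.
rewrite big_cons; apply: rconv_ext (rconvD (cu i) IH) => n.
by rewrite big_cons.
Qed.

Lemma rconv_le u v l m : (forall n, u n <= v n) -> rconv u l -> rconv v m -> l <= m.
Proof.
move=> uv cu cv; rewrite leNgt; apply/negP => lm.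
have e0 : 0 < (l - m) / 2 by rewrite divr_gt0 // subr_gt0.
have [M HM] := cu _ e0; have [N HN] := cv _ e0.
have := HM _ (leq_maxl M N); have := HN _ (leq_maxr M N).
have := uv (maxn M N); rewrite !ltr_norml => h /andP[a b] /andP[c e]; lra.
Qed.

Lemma rconv_uniq u l m : rconv u l -> rconv u m -> l = m.
Proof. by move=> a b; apply/eqP; rewrite eq_le !(@rconv_le u u). Qed.

Lemma rconv_squeeze0 u v : (forall n, `|u n| <= v n) -> rconv v 0 -> rconv u 0.
Proof.
move=> uv cv e /cv [M HM]; exists M => n /HM; rewrite !subr0 => h.
by apply: le_lt_trans (uv n) (le_lt_trans (ler_norm _) h).
Qed.

Lemma rconv_sub0 u l : rconv (fun n => u n - l) 0 <-> rconv u l.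
Proof. by split=> h e /h [M HM]; exists M => n /HM; rewrite subr0. Qed.

Lemma rconv_shift u l k : rconv u l -> rconv (fun n => u (n + k)%N) l.
Proof.
move=> cu e /cu [M HM]; exists M => n h; apply: HM.
exact: leq_trans h (leq_addr _ _).
Qed.

Lemma rconv_sqrt0 u : (forall n, 0 <= u n) ->
  rconv u 0 -> rconv (fun n => Num.sqrt (u n)) 0.
Proof.
move=> u0 cu e e0; have [M HM] := cu _ (exprn_gt0 2 e0).
exists M => n /HM; rewrite !subr0 ger0_norm // (ger0_norm (sqrtr_ge0 _)) => h.
by rewrite -[X in _ < X](ger0_norm (ltW e0)) -sqrtr_sqr ltr_sqrt ?exprn_gt0.
Qed.

Lemma rconv_sqr0 u : rconv u 0 -> rconv (fun n => u n ^+ 2) 0.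
Proof.
move=> cu e e0; have e1 : 0 < Num.sqrt e by rewrite sqrtr_gt0.
have [M HM] := cu _ e1; exists M => n /HM; rewrite !subr0 => h.
rewrite normrX -(sqr_sqrtr (ltW e0)) ltr_pXn2r // ?nnegrE ?normr_ge0 //.
exact: sqrtr_ge0.
Qed.

Lemma rconv_inv : rconv (fun n => (n.+1%:R : R)^-1) 0.
Proof.
move=> e e0; exists (Num.bound (e^-1)) => m h; rewrite subr0 ger0_norm ?invr_ge0 ?ler0n //.
rewrite invf_plt ?posrE ?ltr0n //.
have e1 : 0 <= e^-1 by rewrite invr_ge0 ltW.
by apply: lt_le_trans (archi_boundP e1) _; rewrite ler_nat ltnW.
Qed.

Definition nondec u := forall m n, (m <= n)%N -> u m <= u n.

Lemma nondecS u : (forall n, u n <= u n.+1) -> nondec u.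
Proof.
move=> h m n /subnK <-; elim: (n - m)%N => // k IH.
by rewrite addSn; apply: le_trans IH (h _).
Qed.

Lemma nondec_conv u K : nondec u -> (forall n, u n <= K) ->
  exists l, [/\ rconv u l, (forall n, u n <= l) & l <= K].
Proof.
move=> nu bu; pose E := fun x => exists n, x = u n.
have hE : has_sup E by split; [exists (u 0%N), 0%N | exists K => _ [n ->]].
exists (sup E); split.
- move=> e e0; have [_ [N ->] hN] := sup_adherent e0 hE; exists N => m Nm.
  have h1 : u m <= sup E by apply: ub_le_sup => //; [case: hE | exists m].
  rewrite distrC ger0_norm ?subr_ge0 // ltrBlDr.
  by move: hN; rewrite ltrBlDr => /lt_le_trans; apply; rewrite addrC lerD2l nu.
- by move=> n; apply: ub_le_sup; [case: hE | exists n].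
- by apply: ge_sup; [case: hE | move=> _ [n ->]].
Qed.

Lemma nondec_cauchy u K : nondec u -> (forall n, u n <= K) ->
  forall e, 0 < e -> exists M, forall m n, (M <= m)%N -> (M <= n)%N ->
    `|u m - u n| < e.
Proof.
move=> nu bu e e0; have [l [cl _ _]] := nondec_conv nu bu.
have e2 : 0 < e / 2 by rewrite divr_gt0.
have [M HM] := cl _ e2; exists M => m n /HM h1 /HM h2.
rewrite (_ : u m - u n = (u m - l) - (u n - l)); last by ring.
apply: (le_lt_trans (ler_normB _ _)).
by rewrite [e]splitr ltrD.
Qed.

Lemma cconvP (c : nat -> R[i]) (l : R[i]) : cconv c l <->
  rconv (fun n => complex.Re (c n)) (complex.Re l) /\
  rconv (fun n => complex.Im (c n)) (complex.Im l).
Proof.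
have key z (e : R) : 0 < e -> csq z < e ^+ 2 ->
    `|complex.Re z| < e /\ `|complex.Im z| < e.
  move=> e0 h; split; rewrite -[e]ger0_norm ?ltW // -ltr_sqr ?nnegrE ?normr_ge0 //;
  rewrite !real_normK ?num_real //; apply: le_lt_trans h; rewrite /csq.
    by rewrite lerDl sqr_ge0.
  by rewrite lerDr sqr_ge0.
split.
  move=> h; split=> e e0; have [M HM] := h e e0; exists M => m /HM;
  rewrite normc_lt // => /(key _ _ e0) []; by rewrite ReD ReN ImD ImN.
move=> [h1 h2] e e0; have e2 : 0 < e / 2 by rewrite divr_gt0.
have [M HM] := h1 _ e2; have [N HN] := h2 _ e2.
exists (maxn M N) => m; rewrite geq_max => /andP[/HM a /HN b].
rewrite normc_lt // /csq ReD ReN ImD ImN.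
have sq x : `|x| < e / 2 -> x ^+ 2 <= (e / 2) ^+ 2.
  move=> hx; rewrite -real_normK ?num_real // ler_sqr ?nnegrE ?normr_ge0 //; exact: ltW.
apply: le_lt_trans (lerD (sq _ a) (sq _ b)) _.
have := exprn_gt0 2 e0; nra.
Qed.

End RealLimits.

(** * Hilbert spaces *)

Section InnerProduct.
Variables (R : realType) (V : hilbType R).
Implicit Types (x y z : V) (a : R[i]).

Definition sqn x : R := complex.Re (inner x x).

Lemma inner0l z : inner (0 : V) z = 0.
Proof. by have := innerDl (-1) (0 : V) 0 z; rewrite scaler0 addr0 mulN1r addNr. Qed.
Lemma innerD x y z : inner (x + y) z = inner x z + inner y z.
Proof. by rewrite -{1}[x]scale1r innerDl mul1r. Qed.
Lemma innerZl a x z : inner (a *: x) z = a * inner x z.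
Proof. by rewrite -[a *: x]addr0 innerDl inner0l addr0. Qed.
Lemma innerNl x z : inner (- x) z = - inner x z.
Proof. by rewrite -scaleN1r innerZl mulN1r. Qed.
Lemma innerBl x y z : inner (x - y) z = inner x z - inner y z.
Proof. by rewrite innerD innerNl. Qed.
Lemma inner0r z : inner z (0 : V) = 0.
Proof. by rewrite innerC inner0l conjc0. Qed.
Lemma innerDr x y z : inner z (x + y) = inner z x + inner z y.
Proof. by rewrite innerC innerD conjcD -!innerC. Qed.
Lemma innerZr a x z : inner z (a *: x) = a^*%C * inner z x.
Proof. by rewrite innerC innerZl conjcM -innerC. Qed.
Lemma innerNr x z : inner z (- x) = - inner z x.
Proof. by rewrite innerC innerNl conjcN -innerC. Qed.
Lemma innerBr x y z : inner z (x - y) = inner z x - inner z y.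
Proof. by rewrite innerDr innerNr. Qed.
Lemma inner_suml (I : Type) (s : seq I) (F : I -> V) z :
  inner (\sum_(i <- s) F i) z = \sum_(i <- s) inner (F i) z.
Proof. by elim: s => [|i s IH]; rewrite ?big_nil ?inner0l // !big_cons innerD IH. Qed.
Lemma inner_sumr (I : Type) (s : seq I) (F : I -> V) z :
  inner z (\sum_(i <- s) F i) = \sum_(i <- s) inner z (F i).
Proof. by elim: s => [|i s IH]; rewrite ?big_nil ?inner0r // !big_cons innerDr IH. Qed.

Lemma Re_innerC x y : complex.Re (inner y x) = complex.Re (inner x y).
Proof. by rewrite innerC Re_conj. Qed.
Lemma Im_innerC x y : complex.Im (inner y x) = - complex.Im (inner x y).
Proof. by rewrite innerC Im_conj. Qed.

Lemma innerE x : inner x x = (sqn x)%:C%C.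
Proof.
apply: complex_eqP => //=; have := Im_innerC x x; lra.
Qed.

Lemma sqn_ge0 x : 0 <= sqn x.
Proof. by have := inner_ge0 x; rewrite innerE lecR. Qed.
Lemma sqn_eq0 x : sqn x = 0 -> x = 0.
Proof. by move=> h; apply: inner_eq0; rewrite innerE h. Qed.
Lemma sqn0 : sqn 0 = 0.
Proof. by rewrite /sqn inner0l. Qed.
Lemma sqnD x y : sqn (x + y) = sqn x + sqn y + 2 * complex.Re (inner x y).
Proof. rewrite /sqn innerD !innerDr !ReD (Re_innerC x y); ring. Qed.
Lemma sqnN x : sqn (- x) = sqn x.
Proof. by rewrite /sqn innerNl innerNr opprK. Qed.
Lemma sqnB x y : sqn (x - y) = sqn x + sqn y - 2 * complex.Re (inner x y).
Proof. by rewrite sqnD sqnN innerNr ReN mulrN. Qed.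
Lemma sqnBC x y : sqn (x - y) = sqn (y - x).
Proof. by rewrite -sqnN opprB. Qed.
Lemma sqnZ a x : sqn (a *: x) = csq a * sqn x.
Proof. by rewrite /sqn innerZl innerZr mulrA mulc_conj ReZ. Qed.
Lemma sqnZr (t : R) x : sqn (t%:C%C *: x) = t ^+ 2 * sqn x.
Proof. by rewrite sqnZ csq_real. Qed.

Lemma cauchy_schwarz x y : complex.Re (inner x y) ^+ 2 <= sqn x * sqn y.
Proof.
have [y0|y0] := eqVneq (sqn y) 0.
  by rewrite (sqn_eq0 y0) inner0r sqn0 mulr0 expr0n.
have yp : 0 < sqn y by rewrite lt0r y0 sqn_ge0.
(* The usual x - (r/|y|^2) y is multiplied by |y|^2 to avoid a division; its square is |y|^2 times
   the difference to be bounded. *)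
have := sqn_ge0 ((sqn y)%:C%C *: x - (complex.Re (inner x y))%:C%C *: y).
rewrite sqnB !sqnZr innerZl innerZr ReZ conjc_real ReZ.
set r := complex.Re _; set p := sqn x; set q := sqn y.
have -> : q ^+ 2 * p + r ^+ 2 * q - 2 * (q * (r * r)) = q * (p * q - r ^+ 2) by ring.
by rewrite pmulr_rge0 // subr_ge0.
Qed.

Lemma ipnormE x : ipnorm inner x = Num.sqrt (sqn x).
Proof. by []. Qed.
Lemma ipnorm_ge0 x : 0 <= ipnorm inner x.
Proof. exact: sqrtr_ge0. Qed.
Lemma ipnorm_sqr x : ipnorm inner x ^+ 2 = sqn x.
Proof. by rewrite sqr_sqrtr // sqn_ge0. Qed.
Lemma ipnorm0 : ipnorm inner (0 : V) = 0.
Proof. by rewrite ipnormE sqn0 sqrtr0. Qed.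
Lemma ipnormN x : ipnorm inner (- x) = ipnorm inner x.
Proof. by rewrite !ipnormE sqnN. Qed.
Lemma ipnormBC x y : ipnorm inner (x - y) = ipnorm inner (y - x).
Proof. by rewrite -ipnormN opprB. Qed.
Lemma ipnormZr (t : R) x : 0 <= t -> ipnorm inner (t%:C%C *: x) = t * ipnorm inner x.
Proof.
by move=> t0; rewrite !ipnormE sqnZr sqrtrM ?sqr_ge0 // sqrtr_sqr ger0_norm.
Qed.
Lemma Re_inner_le x y : complex.Re (inner x y) <= ipnorm inner x * ipnorm inner y.
Proof.
apply: le_trans (ler_norm _) _; rewrite -ler_sqr ?nnegrE ?mulr_ge0 ?ipnorm_ge0 ?normr_ge0 //.
by rewrite real_normK ?num_real // exprMn !ipnorm_sqr cauchy_schwarz.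
Qed.
Lemma ipnormD x y : ipnorm inner (x + y) <= ipnorm inner x + ipnorm inner y.
Proof.
rewrite -ler_sqr ?nnegrE ?addr_ge0 ?ipnorm_ge0 //.
rewrite ipnorm_sqr sqnD -!ipnorm_sqr; have := Re_inner_le x y; nra.
Qed.
Lemma ipnorm_sum (I : Type) (s : seq I) (F : I -> V) :
  ipnorm inner (\sum_(i <- s) F i) <= \sum_(i <- s) ipnorm inner (F i).
Proof.
elim: s => [|i s IH]; rewrite ?big_nil ?ipnorm0 // !big_cons.
by apply: le_trans (ipnormD _ _) _; rewrite lerD2l.
Qed.
Lemma ipnorm_le x (t : R) : 0 <= t -> (ipnorm inner x <= t) = (sqn x <= t ^+ 2).
Proof. by move=> t0; rewrite -ipnorm_sqr ler_sqr ?nnegrE ?ipnorm_ge0. Qed.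

(** Weighted Cauchy-Schwarz, the common source of the bounds on rows and on evaluations: [w] will be
    scalar weights such as |l_j|^2 or predecessor ratios, and [t] the energies of the vectors. *)
Lemma sqn_sum_le (I : Type) (s : seq I) (v : I -> V) (w t : I -> R) :
  (forall i, 0 <= w i) -> (forall i, 0 <= t i) ->
  (forall i, sqn (v i) <= w i * t i) ->
  sqn (\sum_(i <- s) v i) <= (\sum_(i <- s) w i) * (\sum_(i <- s) t i).
Proof.
move=> w0 t0 h; elim: s => [|i s IH]; first by rewrite !big_nil sqn0 mulr0.
rewrite !big_cons sqnD.
have : 0 <= \sum_(j <- s) w j by apply: sumr_ge0.
have : 0 <= \sum_(j <- s) t j by apply: sumr_ge0.
move: (h i) (w0 i) (t0 i) IH (cauchy_schwarz (v i) (\sum_(j <- s) v j)).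
move: (sqn_ge0 (v i)) (sqn_ge0 (\sum_(j <- s) v j)).
set a := sqn _; set b := sqn _; set r := complex.Re _.
set W := \sum_(j <- s) w j; set T := \sum_(j <- s) t j.
move: (w i) (t i) => p q a0 b0 apq p0 q0 bWT rab T0 W0.
(* The cross term is bounded by the geometric mean of p T and W q, hence by their arithmetic
   mean. *)
suff : 2 * r <= p * T + W * q by nra.
have rr : r ^+ 2 <= (p * T) * (W * q).
  apply: le_trans rab _; apply: le_trans (ler_pM a0 b0 apq bWT) _.
  by rewrite le_eqVlt; apply/orP; left; apply/eqP; ring.
have u0 : 0 <= p * T by rewrite mulr_ge0.
have v0 : 0 <= W * q by rewrite mulr_ge0.
have : (2 * r) ^+ 2 <= (p * T + W * q) ^+ 2.
  have := sqr_ge0 (p * T - W * q); move: rr; nra.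
by move=> h2; apply: le_trans (ler_norm _) _; rewrite -[leRHS]ger0_norm ?addr_ge0 // -ler_sqr
  ?nnegrE ?normr_ge0 // !real_normK ?num_real.
Qed.

Lemma inner_ext x y : (forall z, inner z x = inner z y) -> x = y.
Proof. by move=> h; apply/subr0_eq/inner_eq0; rewrite innerBr h subrr. Qed.

Lemma polarization x y :
  complex.Re (inner x y) = (sqn (x + y) - sqn (x - y)) / 4.
Proof. by rewrite sqnD sqnB; lra. Qed.

End InnerProduct.

Section VectorLimits.
Variables (R : realType) (V : hilbType R).
Implicit Types (u v : nat -> V) (l : V).
Local Notation nrm := (ipnorm inner).

Lemma vconvP u l : vconv inner u l <-> rconv (fun n => nrm (u n - l)) 0.
Proof.
split=> h e /h [M HM]; exists M => m /HM; rewrite subr0 ger0_norm ?ipnorm_ge0 //.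
Qed.

Lemma vconv_ext u v l : u =1 v -> vconv inner u l -> vconv inner v l.
Proof. by move=> uv cu e /cu [M HM]; exists M => n /HM; rewrite uv. Qed.

Lemma vconv_bound u l (r : nat -> R) :
  (forall n, nrm (u n - l) <= r n) -> rconv r 0 -> vconv inner u l.
Proof.
move=> h cr; apply/vconvP; apply: rconv_squeeze0 cr => n.
by rewrite ger0_norm ?ipnorm_ge0.
Qed.

Lemma vconv_cst l : vconv inner (fun=> l) l.
Proof. by move=> e e0; exists 0%N => m _; rewrite subrr ipnorm0. Qed.

Lemma vconvD u v l m :
  vconv inner u l -> vconv inner v m -> vconv inner (fun n => u n + v n) (l + m).
Proof.
move=> /vconvP cu /vconvP cv; have := rconvD cu cv; rewrite addr0.
by apply: vconv_bound => n; rewrite opprD addrACA ipnormD.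
Qed.

Lemma vconv_shift u l k : vconv inner u l -> vconv inner (fun n => u (n + k)%N) l.
Proof. by move=> /vconvP /(rconv_shift k) h; apply/vconvP. Qed.

Lemma vconv_uniq u l m : vconv inner u l -> vconv inner u m -> l = m.
Proof.
move=> cu cv; apply/subr0_eq/sqn_eq0; rewrite -ipnorm_sqr; apply/eqP.
rewrite sqrf_eq0 eq_le ipnorm_ge0 andbT.
move: cu cv => /vconvP cu /vconvP cv; have := rconvD cu cv; rewrite addr0 => h.
apply: rconv_le (rconv_cst (nrm (l - m))) h => n.
rewrite (ipnormBC (u n) l); apply: le_trans (ipnormD _ _).
by rewrite subrKA.
Qed.

Lemma vconv_sum (I : Type) (s : seq I) (u : I -> nat -> V) (l : I -> V) :
  (forall i, vconv inner (u i) (l i)) ->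
  vconv inner (fun n => \sum_(i <- s) u i n) (\sum_(i <- s) l i).
Proof.
move=> cu; elim: s => [|i s IH].
  by rewrite big_nil; apply: vconv_ext (vconv_cst 0) => n; rewrite big_nil.
rewrite big_cons; apply: vconv_ext (vconvD (cu i) IH) => n.
by rewrite big_cons.
Qed.

(** The offset [z] is there for polarization: the cases z and -z together give continuity of the
    inner product. *)
Lemma rconv_sqn u l : vconv inner u l -> forall z, rconv (fun n => sqn (u n - z)) (sqn (l - z)).
Proof.
move=> /vconvP cu z; apply/rconv_sub0.
have h := rconvD (rconv_sqr0 cu) (rconvZ (2 * nrm (l - z)) cu).
rewrite mulr0 addr0 in h.
apply: rconv_squeeze0 h => n.
have -> : u n - z = (u n - l) + (l - z) by rewrite subrKA.
rewrite sqnD addrAC addrK [X in `|X|](_ : _ = sqn (u n - l) + 2 * complex.Re (inner (u n - l) (l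
  - z))); last by ring.
apply: le_trans (ler_normD _ _) _; rewrite ipnorm_sqr ger0_norm ?sqn_ge0 // lerD2l.
rewrite normrM ger0_norm // -mulrA ler_pM2l // mulrC.
rewrite -ler_sqr ?nnegrE ?mulr_ge0 ?ipnorm_ge0 ?normr_ge0 //.
by rewrite real_normK ?num_real // exprMn !ipnorm_sqr cauchy_schwarz.
Qed.

Lemma rconv_sqn0 u l : vconv inner u l -> rconv (fun n => sqn (u n)) (sqn l).
Proof.
by move=> /rconv_sqn/(_ 0); rewrite subr0; apply: rconv_ext => n; rewrite subr0.
Qed.

Lemma rconv_Re_inner u l z : vconv inner u l ->
  rconv (fun n => complex.Re (inner (u n) z)) (complex.Re (inner l z)).
Proof.
move=> cu; rewrite polarization.
have h1 := rconv_sqn cu (- z); have h2 := rconv_sqn cu z.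
have := rconvZ (4^-1) (rconvB h1 h2); rewrite !opprK mulrC.
by apply: rconv_ext => n; rewrite polarization mulrC.
Qed.

(** A bounded real majorant of the increments gives convergence; it serves both the operator
    iteration for the square root and absolutely convergent series. *)
Lemma vcauchy_dominated u (r : nat -> R) K :
  (forall m n, (m <= n)%N -> nrm (u n - u m) <= r n - r m) -> (forall n, r n <= K) ->
  exists l, vconv inner u l.
Proof.
move=> h bK; apply: inner_complete.
have nr : nondec r.
  by move=> m n /h H; rewrite -subr_ge0; apply: le_trans (ipnorm_ge0 _) H.
move=> e /(nondec_cauchy nr bK) [M HM]; exists M => m n /HM h1 /h1.
case: (leqP m n) => mn.
  rewrite distrC ger0_norm ?subr_ge0 ?nr //; apply: le_lt_trans.
  by rewrite ipnormBC h.
rewrite ger0_norm ?subr_ge0 ?nr ?(ltnW mn) //; apply: le_lt_trans.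
by rewrite h // ltnW.
Qed.

End VectorLimits.

Section LinearMaps.
Variables (R : realType).

Lemma lin0 (V W : lmodType R[i]) (T : V -> W) : lin T -> T 0 = 0.
Proof. by move=> lT; have := lT (-1) 0 0; rewrite scaler0 addr0 scaleN1r addNr. Qed.
Lemma linD (V W : lmodType R[i]) (T : V -> W) : lin T -> forall x y, T (x + y) = T x + T y.
Proof. by move=> lT x y; rewrite -[x]scale1r lT !scale1r. Qed.
Lemma linZ (V W : lmodType R[i]) (T : V -> W) : lin T -> forall a x, T (a *: x) = a *: T x.
Proof. by move=> lT a x; rewrite -[a *: x]addr0 lT lin0 // addr0. Qed.
Lemma linN (V W : lmodType R[i]) (T : V -> W) : lin T -> forall x, T (- x) = - T x.
Proof. by move=> lT x; rewrite -scaleN1r linZ // scaleN1r. Qed.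
Lemma linB (V W : lmodType R[i]) (T : V -> W) : lin T -> forall x y, T (x - y) = T x - T y.
Proof. by move=> lT x y; rewrite linD // linN. Qed.
Lemma lin_sum (V W : lmodType R[i]) (T : V -> W) : lin T ->
  forall (I : Type) (s : seq I) (F : I -> V),
  T (\sum_(i <- s) F i) = \sum_(i <- s) T (F i).
Proof.
by move=> lT I s F; elim: s => [|i s IH]; [rewrite !big_nil lin0|rewrite !big_cons linD // IH].
Qed.

Lemma bounded_vconv (V W : hilbType R) (T : V -> W) : lin T -> bounded inner inner T ->
  forall u l, vconv inner u l -> vconv inner (fun n => T (u n)) (T l).
Proof.
move=> lT [M hM] u l /vconvP cu; have := rconvZ M cu; rewrite mulr0.
by apply: vconv_bound => n; rewrite -linB.
Qed.

Lemma linZ_lin (V : lmodType R[i]) (a : R[i]) : lin (fun x : V => a *: x).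
Proof. by move=> b x y; rewrite scalerDr !scalerA mulrC. Qed.

Lemma bounded_scale (V : hilbType R) (a : R[i]) : bounded inner inner (fun x : V => a *: x).
Proof.
exists (Num.sqrt (csq a)) => x; rewrite !ipnormE sqnZ sqrtrM //; exact: csq_ge0.
Qed.

Lemma vconvZ (V : hilbType R) (a : R[i]) (u : nat -> V) l :
  vconv inner u l -> vconv inner (fun n => a *: u n) (a *: l).
Proof. exact: bounded_vconv (linZ_lin _) (bounded_scale _ _) u l. Qed.

Lemma vconvB (V : hilbType R) (u v : nat -> V) l m :
  vconv inner u l -> vconv inner v m -> vconv inner (fun n => u n - v n) (l - m).
Proof.
move=> cu cv; rewrite -scaleN1r; apply: vconv_ext (vconvD cu (vconvZ (-1) cv)) => n.
by rewrite scaleN1r.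
Qed.

Lemma contraction_bounded (V W : hilbType R) (T : V -> W) :
  (forall x, sqn (T x) <= sqn x) -> bounded inner inner T.
Proof. by move=> h; exists 1 => x; rewrite mul1r !ipnormE ler_sqrt ?sqn_ge0. Qed.

End LinearMaps.

(** * Riesz representation and square roots *)

Section Riesz.
Variable R : realType.
Local Notation nrm := (ipnorm inner).

Lemma quad_ge0_eq0 (q a : R) : 0 <= q ->
  (forall t, 0 <= t ^+ 2 * q + 2 * t * a) -> a = 0.
Proof.
move=> q0 h; have q1 : 0 < q + 1 by rewrite ltr_wpDl.
(* Near the minimiser -a/q, with q + 1 so that q = 0 is allowed; the value there is a negative
   multiple of a^2. *)
have := h (- a / (q + 1)).
have -> : (- a / (q + 1)) ^+ 2 * q + 2 * (- a / (q + 1)) * a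
   = (a ^+ 2 / (q + 1) ^+ 2) * (- (q + 2)).
  by field; rewrite gt_eqF.
have [a0|a0] := eqVneq a 0; first by rewrite a0.
have : 0 < a ^+ 2 / (q + 1) ^+ 2.
  by apply: divr_gt0; [rewrite exprn_even_gt0|exact: exprn_gt0].
move=> H; rewrite pmulr_rge0 //; lra.
Qed.

(* Minimising |T h|^2 - 2 Re (phi h) over h yields the representing vector; it lies
   in the closure of the range of T, so it depends linearly on phi. *)
Lemma riesz_range (H : lmodType R[i]) (K : hilbType R) (T : H -> K) (phi : H -> R[i])
    (c : R) :
  lin T -> (forall a x y, phi (a *: x + y) = a * phi x + phi y) -> 0 <= c ->
  (forall h, complex.Re (phi h) <= c * nrm (T h)) ->
  exists w, [/\ forall h, phi h = inner (T h) w, nrm w <= c &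
    exists s : nat -> H, vconv inner (fun n => T (s n)) w].
Proof.
move=> lT lp c0 hb.
have phi0 : phi 0 = 0.
  by have := lp (-1) 0 0; rewrite scaler0 addr0 mulN1r addNr.
have phiD x y : phi (x + y) = phi x + phi y by rewrite -{1}[x]scale1r lp mul1r.
have phiZ a x : phi (a *: x) = a * phi x by rewrite -[a *: x]addr0 lp phi0 addr0.
pose J h := 2 * complex.Re (phi h) - sqn (T h).
have Jb h : J h <= c ^+ 2.
  rewrite /J -ipnorm_sqr; have := hb h; have := sqr_ge0 (c - nrm (T h)); nra.
pose E := fun r => exists h, r = J h.
have hE : has_sup E.
  by split; [exists (J 0), 0 | exists (c ^+ 2) => _ [h ->]].
pose m := sup E.
have Jm h : J h <= m by apply: ub_le_sup; [case: hE | exists h].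
have ex n : exists h, m - n.+1%:R^-1 < J h.
  have n0 : 0 < (n.+1%:R^-1 : R) by rewrite invr_gt0 ltr0n.
  by have [_ [h ->] hh] := sup_adherent n0 hE; exists h.
have [s hs] := choice ex.
(* Parallelogram law: if x and y nearly maximise J, so does their midpoint, and T x, T y are close.
   The limit is taken in K because H carries no topology. *)
have par x y : sqn (T x - T y) = 4 * J ((2^-1)%:C%C *: (x + y)) - 2 * J x - 2 * J y.
  rewrite /J (linZ lT) (linD lT) phiZ ReZ phiD ReD sqnZr sqnB sqnD.
  by lra.
have cs : vcauchy inner (fun n => T (s n)).
  move=> e e0; have e2 : 0 < e ^+ 2 / 4 by rewrite divr_gt0 // exprn_gt0.
  have [M HM] := @rconv_inv R _ e2; exists M => i j /HM Mi /HM Mj.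
  move: Mi Mj; rewrite !subr0 !ger0_norm ?invr_ge0 ?ler0n // => Mi Mj.
  rewrite -ltr_sqr ?nnegrE ?ipnorm_ge0 ?(ltW e0) // ipnorm_sqr par.
  have := Jm ((2^-1)%:C%C *: (s i + s j)); have := hs i; have := hs j.
  move: Mi Mj; move: (i.+1%:R^-1) (j.+1%:R^-1) (J (s i)) (J (s j)) (J _) => *; lra.
have [w cw] := inner_complete _ cs.
have ReE h : complex.Re (phi h) = complex.Re (inner (T h) w).
  apply/eqP; rewrite eq_sym -subr_eq0; apply/eqP.
  apply: (@quad_ge0_eq0 (sqn (T h))) (sqn_ge0 _) _ => t.
  (* Moving the near-maximiser [s n] by t h gains at most its gap 1/(n+1); in the limit a
     nonnegative quadratic in t remains, so its linear term vanishes. *)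
  have step n : - n.+1%:R^-1 <= t ^+ 2 * sqn (T h)
      + 2 * t * (complex.Re (inner (T (s n)) (T h)) - complex.Re (phi h)).
    have := Jm (t%:C%C *: h + s n); have := hs n.
    rewrite /J (linD lT) (linZ lT) lp ReD ReZ sqnD sqnZr innerZl ReZ (Re_innerC (T (s n)) (T h)).
    move: (n.+1%:R^-1) => i; lra.
  have c1 := rconvN (@rconv_inv R); rewrite oppr0 in c1.
  have c2 := rconvD (rconv_cst (t ^+ 2 * sqn (T h)))
    (rconvZ (2 * t) (rconvB (rconv_Re_inner (T h) cw) (rconv_cst (complex.Re (phi h))))).
  have := rconv_le step c1 c2; by rewrite (Re_innerC (T h) w).
exists w; split.
- move=> h; apply: complex_eqP; first exact: ReE.
  have := ReE (('i%C : R[i]) *: h); rewrite phiZ (linZ lT) innerZl.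
  have ReI (z : R[i]) : complex.Re ('i%C * z) = - complex.Im z.
    by case: z => a b /=; rewrite mul0r mul1r sub0r.
  by rewrite !ReI => /oppr_inj.
(* The bound on phi along [s n] passes to the limit as |w|^2 <= c |w|. *)
- have h n : complex.Re (inner (T (s n)) w) <= c * nrm (T (s n)) by rewrite -ReE hb.
  have c2 : rconv (fun n => nrm (T (s n))) (nrm w).
    apply/rconv_sub0; apply: rconv_squeeze0 (proj1 (vconvP _ _) cw) => n.
    rewrite ler_norml; apply/andP; split.
      rewrite lerNl opprB lerBlDr ipnormBC.
      by apply: le_trans (ipnormD _ _); rewrite subrK.
    by rewrite lerBlDr; apply: le_trans (ipnormD _ _); rewrite subrK.
  have := rconv_le h (rconv_Re_inner w cw) (rconvZ c c2).
  rewrite -/(sqn w) -ipnorm_sqr expr2.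
  have [->|n0] := eqVneq (nrm w) 0; first by [].
  by rewrite ler_pM2r // lt0r n0 ipnorm_ge0.
- by exists s.
Qed.

Lemma adjoint_exists (V W : hilbType R) (T : V -> W) : lin T -> bounded inner inner T ->
  exists Ts : W -> V, is_adjoint inner inner T Ts /\ lin Ts.
Proof.
move=> lT [M hM].
have ex y : exists w, forall x, inner (T x) y = inner x w.
  (* The absolute value is taken because a bound M of an operator on the zero space may be
     negative. *)
  have [||||w [hw _ _]] := @riesz_range V V id (fun x => inner (T x) y) (`|M| * nrm y).
  - by [].
  - by move=> a x z; rewrite lT innerD innerZl.
  - by rewrite mulr_ge0 ?ipnorm_ge0.
  - move=> h; apply: le_trans (Re_inner_le _ _) _.
    rewrite mulrAC ler_wpM2r ?ipnorm_ge0 //; apply: le_trans (hM _) _.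
    by rewrite ler_wpM2r ?ipnorm_ge0 // ler_norm.
  - by exists w.
have [Ts hTs] := choice ex; exists Ts; split=> [x y|a x y]; first exact: hTs.
by apply: inner_ext => z; rewrite -hTs innerDr innerZr !hTs innerDr innerZr.
Qed.

Lemma adjoint_contraction (V W : hilbType R) (T : V -> W) (Ts : W -> V) :
  is_adjoint inner inner T Ts -> (forall x, sqn (T x) <= sqn x) ->
  forall y, sqn (Ts y) <= sqn y.
Proof.
move=> ad hT y; have e : sqn (Ts y) = complex.Re (inner (T (Ts y)) y) by rewrite ad.
have := cauchy_schwarz (T (Ts y)) y; rewrite -e => h.
have [z|nz] := eqVneq (sqn (Ts y)) 0; first by rewrite z sqn_ge0.
have p : 0 < sqn (Ts y) by rewrite lt0r nz sqn_ge0.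
rewrite -(ler_pM2l p) -expr2; apply: le_trans h _.
by rewrite ler_wpM2r ?sqn_ge0.
Qed.

(** Expanding |Ts (T x) - x|^2 gives at most |x|^2 - |T x|^2. The norm condition concerns a single
    vector, so that the lemma also applies to a partial isometry on the complement of its kernel. *)
Lemma isometric_adjoint (V W : hilbType R) (T : V -> W) (Ts : W -> V) :
  is_adjoint inner inner T Ts -> (forall x, sqn (T x) <= sqn x) ->
  forall x, sqn x <= sqn (T x) -> Ts (T x) = x.
Proof.
move=> ad hT x hx; apply/subr0_eq/sqn_eq0/eqP; rewrite eq_le sqn_ge0 andbT.
rewrite sqnB Re_innerC -ad -/(sqn (T x)).
have := adjoint_contraction ad hT (T x); have := hT x; lra.
Qed.

End Riesz.

Section Sqrt.
Variables (R : realType) (K : hilbType R) (G : K -> K).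
Local Notation nrm := (ipnorm inner).
Hypothesis linG : lin G.
Hypothesis adjG : forall x y, inner (G x) y = inner x (G y).
Hypothesis contrG : forall x, sqn (G x) <= sqn x.

(* [cone S a]: S is a polynomial in G with nonnegative coefficients of sum a *)
Inductive cone : (K -> K) -> R -> Prop :=
| cone0 : cone (fun=> 0) 0
| coneG : cone G 1
| coneD S T a b : cone S a -> cone T b -> cone (fun x => S x + T x) (a + b)
| coneM S T a b : cone S a -> cone T b -> cone (fun x => S (T x)) (a * b)
| coneZ t S a : 0 <= t -> cone S a -> cone (fun x => t%:C%C *: S x) (t * a).

Lemma cone_lin S a : cone S a -> lin S.
Proof.
elim=> [|//|S' T b c _ lS _ lT|S' T b c _ lS _ lT|t S' b _ _ lS] k x y.
- by rewrite scaler0 addr0.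
- by rewrite lS lT scalerDr addrACA.
- by rewrite lT lS.
- by rewrite lS scalerDr !scalerA mulrC.
Qed.

(** As G is a contraction, the sum of the nonnegative coefficients bounds the norm. This reduces
    convergence of operators to that of a scalar sequence. *)
Lemma cone_bound S a : cone S a -> 0 <= a /\ forall x, nrm (S x) <= a * nrm x.
Proof.
elim=> [||S' T b c _ [b0 hS] _ [c0 hT]|S' T b c _ [b0 hS] _ [c0 hT]|t S' b t0 _ [b0 hS]].
- by split=> // x; rewrite ipnorm0 mul0r.
- by split=> // x; rewrite mul1r ipnorm_le ?ipnorm_ge0 // ipnorm_sqr.
- split=> [|x]; first exact: addr_ge0.
  by apply: le_trans (ipnormD _ _) _; rewrite mulrDl lerD.
- split=> [|x]; first exact: mulr_ge0.
  by apply: le_trans (hS _) _; rewrite -mulrA ler_wpM2l.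
- split=> [|x]; first exact: mulr_ge0.
  by rewrite ipnormZr // -mulrA ler_wpM2l.
Qed.

Lemma cone_comm_base S a T : cone S a -> lin T -> (forall x, T (G x) = G (T x)) ->
  forall x, T (S x) = S (T x).
Proof.
move=> cS lT h; elim: cS => [|//|S1 S2 b c _ h1 _ h2|S1 S2 b c _ h1 _ h2|t S' b _ _ h1] x.
- exact: lin0.
- by rewrite (linD lT) h1 h2.
- by rewrite h1 h2.
- by rewrite (linZ lT) h1.
Qed.

Lemma cone_comm S a T b : cone S a -> cone T b -> forall x, T (S x) = S (T x).
Proof.
move=> cS cT; apply: cone_comm_base cS (cone_lin cT) _ => x.
by rewrite (cone_comm_base cT linG).
Qed.

Lemma cone_adj S a : cone S a -> forall x y, inner (S x) y = inner x (S y).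
Proof.
elim=> [x y|//|S1 S2 b c _ h1 _ h2 x y|S1 S2 b c c1 h1 c2 h2 x y|t S' b _ _ h1 x y].
- by rewrite inner0l inner0r.
- by rewrite innerD innerDr h1 h2.
- by rewrite h1 h2 (cone_comm c1 c2).
- by rewrite innerZl innerZr conjc_real h1.
Qed.

(* If P is the limit of this iteration, 2 P = G + P^2, so that (1 - P)^2 = 1 - G. *)
Fixpoint sq_iter n : K -> K := if n is n'.+1
  then fun x => (2^-1 : R)%:C%C *: (G x + sq_iter n' (sq_iter n' x)) else fun=> 0.
Fixpoint sq_mass n : R := if n is n'.+1 then 2^-1 * (1 + sq_mass n' * sq_mass n') else 0.

Lemma sq_iter_cone n : cone (sq_iter n) (sq_mass n).
Proof.
elim: n => [|n IH]; first exact: cone0.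
apply: (@coneZ 2^-1 (fun x => G x + sq_iter n (sq_iter n x))); first by rewrite invr_ge0.
by apply: coneD coneG _; apply: coneM.
Qed.

(** With P_n the iterates, which commute, P_(n+2) - P_(n+1) is half the product of P_(n+1) - P_n and
    P_(n+1) + P_n. Increments thus keep nonnegative coefficients, and their masses telescope. *)
Lemma sq_iter_diff n :
  cone (fun x => sq_iter n.+1 x - sq_iter n x) (sq_mass n.+1 - sq_mass n).
Proof.
elim: n => [|n IH].
  rewrite (_ : (fun x => _) = fun x => (2^-1 : R)%:C%C *: (G x + 0)); last first.
    by apply/funext => x /=; rewrite subr0.
  rewrite (_ : _ - _ = 2^-1 * (1 + 0)); last by rewrite /=; ring.
  by apply: (@coneZ 2^-1 (fun x => G x + 0)); [rewrite invr_ge0|exact: coneD coneG cone0].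
have cn := sq_iter_cone n; have cn1 := sq_iter_cone n.+1.
rewrite (_ : (fun x => _) = fun x => (2^-1 : R)%:C%C *:
   ((fun z => sq_iter n.+1 z - sq_iter n z) (sq_iter n.+1 x + sq_iter n x))); last first.
  apply/funext => x; rewrite -[sq_iter n.+2 x]/((2^-1 : R)%:C%C *: (G x + sq_iter n.+1 (sq_iter
    n.+1 x))).
  rewrite -[X in _ - X = _]/((2^-1 : R)%:C%C *: (G x + sq_iter n (sq_iter n x))).
  rewrite -scalerBr; congr (_ *: _).
  rewrite (linD (cone_lin cn1)) (linD (cone_lin cn)) (cone_comm cn1 cn).
  by rewrite opprD addrACA subrr add0r opprD !addrA addrK.
rewrite (_ : _ - _ = 2^-1 * ((sq_mass n.+1 - sq_mass n) * (sq_mass n.+1 + sq_mass n))); last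
  first.
  rewrite -[LHS]/(2^-1 * (1 + sq_mass n.+1 * sq_mass n.+1) - 2^-1 * (1 + sq_mass n * sq_mass n)).
  by ring.
apply: (@coneZ 2^-1 (fun x => sq_iter n.+1 (sq_iter n.+1 x + sq_iter n x) - sq_iter n (sq_iter
  n.+1 x + sq_iter n x))).
  by rewrite invr_ge0.
exact: coneM IH (coneD cn1 cn).
Qed.

Lemma sq_mass_le1 n : sq_mass n <= 1.
Proof.
elim: n => [|n IH] //=; have [h _] := cone_bound (sq_iter_cone n); nra.
Qed.

Lemma sqrt_exists : exists Q : K -> K,
  [/\ lin Q, (forall x y, inner (Q x) y = inner x (Q y)) & forall x, Q (Q x) = x - G x].
Proof.
have dist x m n : (m <= n)%N ->
    nrm (sq_iter n x - sq_iter m x) <= sq_mass n * nrm x - sq_mass m * nrm x.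
  move=> /subnK <-; elim: (n - m)%N => [|k IH]; first by rewrite !subrr ipnorm0.
  rewrite addSn -(subrKA (sq_iter (k + m) x)); apply: le_trans (ipnormD _ _) _.
  have [_ /(_ x) h] := cone_bound (sq_iter_diff (k + m)); lra.
have lim x : exists l, vconv inner (fun n => sq_iter n x) l.
  apply: (@vcauchy_dominated _ _ _ (fun n => sq_mass n * nrm x) (nrm x)) (dist x) _ => n.
  by rewrite ler_piMl ?ipnorm_ge0 // sq_mass_le1.
have [P cP] := choice lim.
have linP : lin P.
  move=> a x y; apply: vconv_uniq (cP _) _.
  apply: vconv_ext (vconvD (vconvZ a (cP x)) (cP y)) => n.
  by rewrite (cone_lin (sq_iter_cone n)).
have adjP x y : inner (P x) y = inner x (P y).
  have ReA x' y' : complex.Re (inner (P x') y') = complex.Re (inner x' (P y')).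
    apply: rconv_uniq (rconv_Re_inner _ (cP x')) _; rewrite Re_innerC.
    apply: rconv_ext (rconv_Re_inner x' (cP y')) => n.
    by rewrite Re_innerC (cone_adj (sq_iter_cone n)).
  apply: complex_eqP; first exact: ReA.
  have := ReA (('i%C : R[i]) *: x) y; rewrite (linZ linP) !innerZl.
  have ReI (z : R[i]) : complex.Re ('i%C * z) = - complex.Im z.
    by case: z => a b /=; rewrite mul0r mul1r sub0r.
  by rewrite !ReI => /oppr_inj.
have PP x : P x = (2^-1 : R)%:C%C *: (G x + P (P x)).
  apply: vconv_uniq (vconv_shift 1 (cP x)) _.
  apply: vconv_ext (vconvZ _ (vconvD (vconv_cst (G x)) _)).
    by move=> n; rewrite addn1.
  (* The iterates are uniformly contractive, so P_n (P_n x - P x) tends to 0 and P_n (P_n x) has the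
     same limit as P_n (P x). *)
  have h1 : vconv inner (fun n => sq_iter n (sq_iter n x - P x)) 0.
    apply: vconv_bound (proj1 (vconvP _ _) (cP x)) => n; rewrite subr0.
    have [_ h] := cone_bound (sq_iter_cone n); apply: le_trans (h _) _.
    by rewrite ler_piMl ?ipnorm_ge0 // sq_mass_le1.
  rewrite -[P (P x)]add0r; apply: vconv_ext (vconvD h1 (cP (P x))) => n.
  by rewrite (linB (cone_lin (sq_iter_cone n))) subrK.
exists (fun x => x - P x); split.
- by move=> a x y; rewrite linP opprD addrACA scalerBr.
- by move=> x y; rewrite innerBl innerBr adjP.
- move=> x; rewrite (linB linP) opprB.
  have : P x + P x = G x + P (P x).
    rewrite {1 2}PP -scalerDr -mulr2n -scaler_nat scalerA natCr -rmorphM /=.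
    by rewrite mulVf ?scale1r // pnatr_eq0.
  move=> h; have -> : G x = P x + P x - P (P x) by rewrite h addrK.
  by rewrite opprB -addrA; congr (x + _); rewrite opprD addrCA.
Qed.

End Sqrt.

(** * Constructions of Hilbert spaces *)

Section Instances.
Variable R : realType.

Section Product.
Variables V W : hilbType R.
Local Notation ip := (ip_sum (@inner R V) (@inner R W)).

Lemma ip_sumDl a (x y z : V * W) : ip (a *: x + y) z = a * ip x z + ip y z.
Proof. rewrite /ip_sum !innerDl; ring. Qed.
Lemma ip_sumC (x y : V * W) : ip y x = (ip x y)^*%C.
Proof. by rewrite /ip_sum (innerC x.1) (innerC x.2) conjcD. Qed.
Lemma ip_sum_ge0 (x : V * W) : 0 <= ip x x.
Proof. by rewrite addr_ge0 ?inner_ge0. Qed.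
Lemma ip_sumE (x : V * W) : complex.Re (ip x x) = sqn x.1 + sqn x.2.
Proof. by rewrite /ip_sum ReD. Qed.
Lemma ip_sum_eq0 (x : V * W) : ip x x = 0 -> x = 0.
Proof.
move=> /(congr1 (@complex.Re _)); rewrite ip_sumE /=.
have := sqn_ge0 x.1; have := sqn_ge0 x.2; case: x => x y /= h1 h2 h3.
by congr pair; apply: sqn_eq0; lra.
Qed.
Lemma ip_sum_complete (u : nat -> V * W) : vcauchy ip u -> exists l, vconv ip u l.
Proof.
move=> cu.
have c1 : vcauchy inner (fun n => (u n).1).
  move=> e /cu [M HM]; exists M => m n h1 h2; apply: le_lt_trans (HM m n h1 h2).
  by rewrite /ipnorm ip_sumE ler_sqrt ?lerDl ?addr_ge0 ?sqn_ge0.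
have c2 : vcauchy inner (fun n => (u n).2).
  move=> e /cu [M HM]; exists M => m n h1 h2; apply: le_lt_trans (HM m n h1 h2).
  by rewrite /ipnorm ip_sumE ler_sqrt ?lerDr ?addr_ge0 ?sqn_ge0.
have [x cx] := inner_complete _ c1; have [y cy] := inner_complete _ c2.
exists (x, y).
have h := rconvD (rconv_sqr0 (proj1 (vconvP _ _) cx)) (rconv_sqr0 (proj1 (vconvP _ _) cy)).
rewrite addr0 in h; move: h => /rconv_sqrt0 h e e0.
have [|M HM] := h _ e e0; first by move=> n; rewrite addr_ge0 ?sqr_ge0.
exists M => m /HM; rewrite subr0 ger0_norm ?sqrtr_ge0 //.
by rewrite /ipnorm ip_sumE -/(ipnorm _ _) !sqr_sqrtr ?sqn_ge0.
Qed.
HB.instance Definition _ := Lmodule_isHilbert.Build R (V * W)%type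
  ip_sumDl ip_sumC ip_sum_ge0 ip_sum_eq0 ip_sum_complete.
End Product.

Lemma sqn_pair (V W : hilbType R) (x : V * W) : sqn x = sqn x.1 + sqn x.2.
Proof. exact: ip_sumE. Qed.
Lemma inner_pair (V W : hilbType R) (x y : V * W) :
  inner x y = inner x.1 y.1 + inner x.2 y.2.
Proof. by []. Qed.

Section Power.
Variables (d : nat) (V : hilbType R).
Implicit Types x y z : {ffun 'I_d -> V}.
Definition ip_pow x y : R[i] := \sum_j inner (x j) (y j).

Lemma ip_powDl a x y z : ip_pow (a *: x + y) z = a * ip_pow x z + ip_pow y z.
Proof.
rewrite /ip_pow mulr_sumr -big_split; apply: eq_bigr => j _ /=.
by rewrite !ffunE innerDl.
Qed.
Lemma ip_powC x y : ip_pow y x = (ip_pow x y)^*%C.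
Proof.
rewrite /ip_pow (big_morph _ (@conjcD R) (conjc0 R)); apply: eq_bigr => j _.
exact: innerC.
Qed.
Lemma ip_pow_ge0 x : 0 <= ip_pow x x.
Proof. by apply: sumr_ge0 => j _; apply: inner_ge0. Qed.
Lemma ip_powE x : complex.Re (ip_pow x x) = \sum_j sqn (x j).
Proof. exact: Re_sum. Qed.
Lemma ip_pow_coord x j : sqn (x j) <= complex.Re (ip_pow x x).
Proof.
by rewrite ip_powE (bigD1 j) //= lerDl sumr_ge0 // => i _; apply: sqn_ge0.
Qed.
Lemma ip_pow_eq0 x : ip_pow x x = 0 -> x = 0.
Proof.
move=> /(congr1 (@complex.Re _)) h; apply/ffunP => j; rewrite ffunE; apply: sqn_eq0.
by apply/eqP; rewrite eq_le sqn_ge0 andbT (le_trans (ip_pow_coord x j)) // h.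
Qed.
Lemma ip_pow_complete (u : nat -> {ffun 'I_d -> V}) :
  vcauchy ip_pow u -> exists l, vconv ip_pow u l.
Proof.
move=> cu.
have c j : vcauchy inner (fun n => u n j).
  move=> e /cu [M HM]; exists M => m n h1 h2; apply: le_lt_trans (HM m n h1 h2).
  rewrite /ipnorm ler_sqrt; last by apply: le_trans (ip_pow_coord _ j); apply: sqn_ge0.
  by apply: le_trans (ip_pow_coord _ j); rewrite !ffunE.
have [x cx] := choice (fun j => inner_complete _ (c j)).
exists [ffun j => x j].
have h : rconv (fun n => \sum_j ipnorm inner (u n j - x j) ^+ 2) (\sum_(j < d) 0).
  by apply: rconv_sum => j; apply: rconv_sqr0 (proj1 (vconvP _ _) (cx j)).
rewrite big1 // in h; move: h => /rconv_sqrt0 h e e0.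
have [|M HM] := h _ e e0; first by move=> n; rewrite sumr_ge0 // => j _; rewrite sqr_ge0.
exists M => m /HM; rewrite subr0 ger0_norm ?sqrtr_ge0 //.
rewrite /ipnorm ip_powE; congr (Num.sqrt _ < _); apply: eq_bigr => j _.
by rewrite !ffunE sqr_sqrtr ?sqn_ge0.
Qed.
HB.instance Definition _ := Lmodule_isHilbert.Build R {ffun 'I_d -> V}
  ip_powDl ip_powC ip_pow_ge0 ip_pow_eq0 ip_pow_complete.
End Power.

Lemma sqn_ffun d (V : hilbType R) (x : {ffun 'I_d -> V}) : sqn x = \sum_j sqn (x j).
Proof. exact: ip_powE. Qed.
Lemma inner_ffun d (V : hilbType R) (x y : {ffun 'I_d -> V}) :
  inner x y = \sum_j inner (x j) (y j).
Proof. by []. Qed.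

Section OrthogonalComplement.
Variables (K : hilbType R) (E : K -> Prop).

Definition orthp : {pred K} := fun h => `[< forall e, E e -> inner h e = 0 >].

Lemma orthpP h : reflect (forall e, E e -> inner h e = 0) (h \in orthp).
Proof. exact: asboolP. Qed.

Lemma orthp_submod : GRing.submod_closed orthp.
Proof.
split=> [|a x y /orthpP hx /orthpP hy]; apply/orthpP => e Ee; first by rewrite inner0l.
by rewrite innerDl hx // hy // mulr0 addr0.
Qed.
HB.instance Definition _ := GRing.isSubmodClosed.Build R[i] K orthp orthp_submod.

Record orth := Orth { oval :> K; ovalP : oval \in orthp }.
HB.instance Definition _ := [isSub for oval].
HB.instance Definition _ := [Choice of orth by <:].
HB.instance Definition _ := [SubChoice_isSubLmodule of orth by <:].

Definition ip_orth (x y : orth) : R[i] := inner (oval x) (oval y).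
Lemma ip_orthDl a x y z : ip_orth (a *: x + y) z = a * ip_orth x z + ip_orth y z.
Proof. exact: innerDl. Qed.
Lemma ip_orthC x y : ip_orth y x = (ip_orth x y)^*%C.
Proof. exact: innerC. Qed.
Lemma ip_orth_ge0 x : 0 <= ip_orth x x.
Proof. exact: inner_ge0. Qed.
Lemma ip_orth_eq0 x : ip_orth x x = 0 -> x = 0.
Proof. by move=> /inner_eq0 h; apply: val_inj. Qed.
Lemma ip_orth_complete (u : nat -> orth) : vcauchy ip_orth u -> exists l, vconv ip_orth u l.
Proof.
move=> cu; have [x cx] := inner_complete (fun n => oval (u n)) cu.
have ReO z : (forall n, complex.Re (inner (oval (u n)) z) = 0) -> complex.Re (inner x z) = 0.
  move=> h; apply: rconv_uniq (rconv_Re_inner z cx) _.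
  by apply: rconv_ext (rconv_cst 0) => n; rewrite h.
have hx : x \in orthp.
  apply/orthpP => e Ee; apply: complex_eqP.
    by apply: ReO => n; have /orthpP -> := ovalP (u n).
  have : complex.Re (inner x (('i%C : R[i]) *: e)) = 0.
    by apply: ReO => n; rewrite innerZr; have /orthpP -> := ovalP (u n); rewrite ?mulr0.
  by rewrite innerZr; case: (inner x e) => a b /=; lra.
by exists (Orth hx).
Qed.
HB.instance Definition _ := Lmodule_isHilbert.Build R orth
  ip_orthDl ip_orthC ip_orth_ge0 ip_orth_eq0 ip_orth_complete.

Lemma inner_orth (x y : orth) : inner x y = inner (oval x) (oval y).
Proof. by []. Qed.
Lemma sqn_orth (x : orth) : sqn x = sqn (oval x).
Proof. by []. Qed.
Lemma oval_lin : lin oval.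
Proof. by []. Qed.
End OrthogonalComplement.

End Instances.

(** * Multi-indices *)

Section MultiIndices.
Variable d : nat.
Local Notation mi := {ffun 'I_d -> nat}.
Implicit Types (n m : mi) (j : 'I_d).

Definition mi0 : mi := [ffun => 0%N].
Definition inc j n : mi := [ffun i => (n i + (i == j))%N].
(** The subtraction is truncated, so [dec j n] is a predecessor only if n j > 0; sums over
    predecessors carry that guard. *)
Definition dec j n : mi := [ffun i => (n i - (i == j))%N].

Lemma incE j n : inc j n j = (n j).+1.
Proof. by rewrite ffunE eqxx addn1. Qed.
Lemma incNE i j n : i != j -> inc j n i = n i.
Proof. by move=> /negPf h; rewrite ffunE h addn0. Qed.
Lemma decK j n : (0 < n j)%N -> inc j (dec j n) = n.
Proof.
move=> h; apply/ffunP => i; rewrite !ffunE.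
by case: eqVneq => [->|_]; rewrite ?subnK // subn0 addn0.
Qed.
Lemma incK j n : dec j (inc j n) = n.
Proof. by apply/ffunP => i; rewrite !ffunE addnK. Qed.
Lemma inc_inj j : injective (inc j).
Proof. exact: can_inj (incK j). Qed.
Lemma incC i j n : inc i (inc j n) = inc j (inc i n).
Proof. by apply/ffunP => k; rewrite !ffunE addnAC. Qed.

Lemma mdeg_inc j n : mdeg (inc j n) = (mdeg n).+1.
Proof.
rewrite /mdeg (bigD1 j) //= [X in _ = X.+1](bigD1 j) //= incE; congr (_ + _).+1.
by apply: eq_bigr => i /incNE ->.
Qed.
Lemma mdeg_dec j n : (0 < n j)%N -> (mdeg (dec j n)).+1 = mdeg n.
Proof. by move=> h; rewrite -(mdeg_inc j) decK. Qed.
Lemma mdeg0 : mdeg mi0 = 0%N.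
Proof. by rewrite /mdeg big1 // => j _; rewrite ffunE. Qed.
Lemma mdeg_eq0 n : (mdeg n == 0%N) = (n == mi0).
Proof.
apply/eqP/eqP => [h|->]; last exact: mdeg0.
apply/ffunP => j; rewrite ffunE; apply/eqP; rewrite -leqn0 -h.
by rewrite /mdeg (bigD1 j) //= leq_addr.
Qed.
Lemma mdeg_gt0 n : (0 < mdeg n)%N -> exists j, (0 < n j)%N.
Proof.
move=> h; apply: contrapT => H; have : n = mi0.
  apply/ffunP => j; rewrite ffunE; apply/eqP; rewrite -leqn0 leqNgt.
  by apply/negP => hj; apply: H; exists j.
by move=> e; rewrite e mdeg0 in h.
Qed.

Lemma mfact_inc j n : mfact (inc j n) = ((n j).+1 * mfact n)%N.
Proof.
rewrite /mfact (bigD1 j) //= [X in _ = (_ * X)%N](bigD1 j) //= incE factS -mulnA.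
by congr (_ * (_ * _))%N; apply: eq_bigr => i /incNE ->.
Qed.
Lemma mfact_gt0 n : (0 < mfact n)%N.
Proof. by apply: prodn_gt0 => j; apply: fact_gt0. Qed.
Lemma mfact0 : mfact mi0 = 1%N.
Proof. by rewrite /mfact big1 // => j _; rewrite ffunE. Qed.

Lemma mem_level N n : (n \in level d N) = (mdeg n == N).
Proof.
apply/mapP/idP => [[m]|/eqP h].
  by rewrite mem_filter => /andP[h _] ->.
have hn j : (n j < N.+1)%N by rewrite ltnS -h /mdeg (bigD1 j) //= leq_addr.
have E : n = mi_of [ffun j => Ordinal (hn j)] by apply/ffunP => j; rewrite !ffunE.
by exists [ffun j => Ordinal (hn j)] => //; rewrite mem_filter -E h eqxx mem_enum.
Qed.

Lemma level_uniq N : uniq (level d N).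
Proof.
rewrite map_inj_uniq; first by rewrite filter_uniq // enum_uniq.
move=> m m' /ffunP e; apply/ffunP => j; apply: val_inj.
by have := e j; rewrite !ffunE.
Qed.

Lemma level0 : level d 0 = [:: mi0].
Proof.
apply: perm_small_eq => //; apply: uniq_perm => //; first exact: level_uniq.
by move=> n; rewrite mem_level mdeg_eq0 inE.
Qed.

Lemma sum_level_pos (V : nmodType) j N (G : mi -> V) :
  \sum_(n <- level d N.+1 | (0 < n j)%N) G n = \sum_(m <- level d N) G (inc j m).
Proof.
rewrite -big_filter -[RHS](big_map (inc j) xpredT G); apply: perm_big.
apply: uniq_perm; first by rewrite filter_uniq ?level_uniq.
  by rewrite map_inj_uniq ?level_uniq //; apply: inc_inj.
move=> n; rewrite mem_filter mem_level; apply/andP/mapP => [[h /eqP hN]|[m]].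
  exists (dec j n); last by rewrite decK.
  by rewrite mem_level -eqSS mdeg_dec // hN.
by rewrite mem_level => /eqP <- ->; rewrite incE mdeg_inc.
Qed.

(** Double counting of the edges between degrees N and N+1, read from above (predecessors) and from
    below (successors). Every comparison of energies of consecutive degrees goes through it. *)
Lemma sum_level_inc (V : nmodType) N (G : 'I_d -> mi -> V) :
  \sum_(n <- level d N.+1) \sum_(j | (0 < n j)%N) G j n
  = \sum_j \sum_(m <- level d N) G j (inc j m).
Proof.
rewrite (exchange_big_dep xpredT) //=; apply: eq_bigr => j _.
exact: sum_level_pos.
Qed.

Lemma sum_mdeg (A : pzSemiRingType) n : \sum_(j | (0 < n j)%N) ((n j)%:R : A) = (mdeg n)%:R.
Proof.
rewrite /mdeg natr_sum [RHS](bigID (fun j => (0 < n j)%N)) /=.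
rewrite [X in _ = _ + X]big1 ?addr0 // => j.
by rewrite -leqNgt leqn0 => /eqP ->.
Qed.

Lemma mi_ind (P : mi -> Prop) :
  P mi0 -> (forall j n, P n -> P (inc j n)) -> forall n, P n.
Proof.
move=> P0 PS n; have [N] := ubnP (mdeg n); elim: N n => // N IH n.
rewrite ltnS => hN; case: (posnP (mdeg n)) => [/eqP|/mdeg_gt0 [j hj]].
  by rewrite mdeg_eq0 => /eqP ->.
by rewrite -(decK hj); apply/PS/IH; rewrite mdeg_dec.
Qed.

End MultiIndices.
Arguments mi0 {d}.

Section Weights.
Variables (R : realType) (d : nat).
Local Notation mi := {ffun 'I_d -> nat}.
Implicit Types (n m : mi) (j : 'I_d).

(** For N = |n| this is the squared Drury-Arveson norm of the monomial of exponent n, and the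
    inverse of a multinomial coefficient. *)
Definition wt N n : R := (mfact n)%:R / N`!%:R.

Lemma wt_gt0 N n : 0 < wt N n.
Proof. by rewrite divr_gt0 // ltr0n ?mfact_gt0 ?fact_gt0. Qed.
Lemma wt_ge0 N n : 0 <= wt N n.
Proof. exact/ltW/wt_gt0. Qed.
Lemma wt0 : wt 0 mi0 = 1.
Proof. by rewrite /wt mfact0 divr1. Qed.

(** The factor by which multiplication by the j-th coordinate changes the squared norm of a monomial
    of degree N. Over the predecessors of one multi-index these factors form a probability
    distribution ([sum_ratio]). *)
Definition ratio N j n : R := (n j).+1%:R / N.+1%:R.

Lemma ratio_gt0 N j n : 0 < ratio N j n.
Proof. by rewrite divr_gt0 ?ltr0n. Qed.

Lemma wt_inc N j n : wt N.+1 (inc j n) = wt N n * ratio N j n.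
Proof.
rewrite /wt /ratio mfact_inc factS !natrM mulf_div.
by congr (_ / _); rewrite mulrC.
Qed.

Lemma sum_ratio N n : mdeg n = N.+1 -> \sum_(j | (0 < n j)%N) ratio N j (dec j n) = 1.
Proof.
move=> h; under eq_bigr => j hj do rewrite /ratio -incE decK //.
by rewrite -mulr_suml sum_mdeg h divff // pnatr_eq0.
Qed.

Definition sqmod (l : 'I_d -> R[i]) : R := \sum_j csq (l j).

Lemma sqmod_ge0 l : 0 <= sqmod l.
Proof. by apply: sumr_ge0 => j _; apply: csq_ge0. Qed.

Lemma inballE l : inball l <-> sqmod l < 1.
Proof.
rewrite /inball /cinner; under eq_bigr => j _ do rewrite mulc_conj.
rewrite -(big_morph _ (raddfD (real_complex R)) (raddf0 (real_complex R))).
by rewrite -[X in _ < X]/(1%:C%C) ltcR.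
Qed.

Lemma mono_inc (l : 'I_d -> R[i]) j n : mono l (inc j n) = l j * mono l n .
Proof.
rewrite /mono (bigD1 j) //= [X in _ = _ * X](bigD1 j) //= incE exprS -mulrA.
by congr (_ * (_ * _)); apply: eq_bigr => i /incNE ->.
Qed.

Lemma mono0 (l : 'I_d -> R[i]) : mono l mi0 = 1 .
Proof. by rewrite /mono big1 // => j _; rewrite ffunE. Qed.

(** The multinomial theorem, i.e. the degree N part of the kernel k_d on the diagonal. The induction
    splits 1/wt over predecessors by Pascal's rule, which is [sum_ratio] divided by the weight. *)
Lemma multinomial l N : \sum_(n <- level d N) csq (mono l n) / wt N n = sqmod l ^+ N.
Proof.
elim: N => [|N IH].
  by rewrite level0 big_seq1 mono0 csq1 wt0 divr1.
have -> : \sum_(n <- level d N.+1) csq (mono l n) / wt N.+1 n =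
  \sum_(n <- level d N.+1) \sum_(j | (0 < n j)%N)
      csq (mono l n) / wt N (dec j n).
  apply: eq_big_seq => n; rewrite mem_level => /eqP hn.
  rewrite -mulr_sumr; congr (_ * _).
  rewrite -[LHS]mulr1 -(sum_ratio hn) mulr_sumr; apply: eq_bigr => j hj.
  rewrite -{1}(decK hj) wt_inc; have := wt_gt0 N (dec j n); have := ratio_gt0 N j (dec j n).
  by move: (wt _ _) (ratio _ _ _) => a b b0 a0; field; rewrite !gt_eqF.
rewrite sum_level_inc exprS -IH /sqmod mulr_suml; apply: eq_bigr => j _.
rewrite mulr_sumr; apply: eq_bigr => m _.
by rewrite incK mono_inc csqM mulrA.
Qed.

End Weights.

(** * The Drury-Arveson space *)

Section ComplexLimits.
Variable R : realType.
Implicit Types (u v : nat -> R[i]) (l m a : R[i]).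

Lemma cconv_uniq u l m : cconv u l -> cconv u m -> l = m.
Proof.
move=> /cconvP[a b] /cconvP[a' b'].
by apply: complex_eqP; [exact: rconv_uniq a a'|exact: rconv_uniq b b'].
Qed.

Lemma cconv_lin a u v l m :
  cconv u l -> cconv v m -> cconv (fun n => a * u n + v n) (a * l + m).
Proof.
move=> /cconvP[u1 u2] /cconvP[v1 v2]; apply/cconvP; case: a => p q.
have ReM z : complex.Re ((p +i* q)%C * z) = p * complex.Re z - q * complex.Im z by case: z.
have ImM z : complex.Im ((p +i* q)%C * z) = p * complex.Im z + q * complex.Re z by case: z.
split; [rewrite ReD ReM|rewrite ImD ImM].
  apply: rconv_ext (rconvD (rconvB (rconvZ p u1) (rconvZ q u2)) v1) => n.
  by rewrite ReD ReM.
apply: rconv_ext (rconvD (rconvD (rconvZ p u2) (rconvZ q u1)) v2) => n.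
by rewrite ImD ImM.
Qed.

Lemma cconv_ext u v l : u =1 v -> cconv u l -> cconv v l.
Proof. by move=> uv cu e /cu [M HM]; exists M => n /HM; rewrite uv. Qed.

Lemma cconv_conj u l : cconv u l -> cconv (fun n => (u n)^*%C) l^*%C.
Proof.
move=> /cconvP[a b]; apply/cconvP; rewrite Re_conj Im_conj; split.
  by apply: rconv_ext a => n; rewrite Re_conj.
by apply: rconv_ext (rconvN b) => n; rewrite Im_conj.
Qed.
End ComplexLimits.

Section Levels.
Variables (R : realType) (d : nat) (V : hilbType R).
Local Notation mi := {ffun 'I_d -> nat}.
Implicit Types (c : mi -> V) (n m : mi) (j : 'I_d).

Definition lev c N : R := \sum_(n <- level d N) wt R N n * sqn (c n).

Lemma lev_ge0 c N : 0 <= lev c N.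
Proof. by apply: sumr_ge0 => n _; rewrite mulr_ge0 ?wt_ge0 ?sqn_ge0. Qed.

Lemma lev0 c : lev c 0 = sqn (c mi0).
Proof. by rewrite /lev level0 big_seq1 wt0 mul1r. Qed.

Lemma eq_lev c c' N : (forall n, mdeg n = N -> c n = c' n) -> lev c N = lev c' N.
Proof. by move=> h; apply: eq_big_seq => n; rewrite mem_level => /eqP /h ->. Qed.

Lemma DAsqE c M : DAsq inner c M = \sum_(N < M) lev c N.
Proof. by apply: eq_bigr => N _; apply: eq_bigr => n _; rewrite ipnorm_sqr. Qed.

Lemma DAsqS c M : DAsq inner c M.+1 = DAsq inner c M + lev c M.
Proof. by rewrite !DAsqE big_ord_recr. Qed.

Lemma DAsq_nondec c : nondec (DAsq inner c).
Proof. by apply: nondecS => n; rewrite DAsqS lerDl lev_ge0. Qed.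

Lemma lev_le_DAsq c N : lev c N <= DAsq inner c N.+1.
Proof.
rewrite DAsqS lerDr; have := @DAsq_nondec c 0%N N (leq0n _).
by rewrite DAsqE big_ord0.
Qed.

Lemma coef_le_lev c n : wt R (mdeg n) n * sqn (c n) <= lev c (mdeg n).
Proof.
rewrite /lev (bigD1_seq n) ?level_uniq ?mem_level //= lerDl sumr_ge0 // => m _.
by rewrite mulr_ge0 ?wt_ge0 ?sqn_ge0.
Qed.

(** Contractivity of the row of shifts, one degree at a time: Cauchy-Schwarz over the predecessors
    of n, with the ratios, of sum 1, as weights. *)
Lemma lev_row (w : 'I_d -> mi -> V) N :
  lev (fun n => \sum_(j | (0 < n j)%N) w j (dec j n)) N.+1 <= \sum_j lev (w j) N.
Proof.
rewrite /lev.
have -> : \sum_j \sum_(m <- level d N) wt R N m * sqn (w j m) =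
   \sum_(n <- level d N.+1) \sum_(j | (0 < n j)%N) wt R N (dec j n) * sqn (w j (dec j n)).
  rewrite sum_level_inc; apply: eq_bigr => j _; apply: eq_bigr => m _.
  by rewrite incK.
rewrite big_seq [X in _ <= X]big_seq; apply: ler_sum => n.
rewrite mem_level => /eqP hn; rewrite -[X in sqn X]big_filter.
set s := [seq _ <- _ | _].
have := @sqn_sum_le _ _ _ s (fun j => w j (dec j n)) (fun j => ratio R N j (dec j n))
   (fun j => sqn (w j (dec j n)) / ratio R N j (dec j n)).
have r0 j m : 0 < ratio R N j m by apply: ratio_gt0.
move=> /(_ (fun j => ltW (r0 _ _))) H.
have {H} := H _ _; rewrite !big_filter (sum_ratio _ hn) mul1r => H.
rewrite -[X in _ <= X]mulr1.
apply: le_trans (_ : wt R N.+1 n * (\sum_(j | (0 < n j)%N) sqn (w j (dec j n)) / ratio R N j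
  (dec j n)) <= _).
  rewrite ler_wpM2l ?wt_ge0 // H // => j; first by rewrite divr_ge0 ?sqn_ge0 // ltW.
  by rewrite mulrC divfK ?gt_eqF.
rewrite mulr1 mulr_sumr; apply: ler_sum => j hj.
by rewrite -{1}(decK hj) wt_inc -mulrA [ratio _ _ _ _ * _]mulrC divfK ?gt_eqF.
Qed.

(* adjoint of multiplication by the j-th coordinate *)
Definition bshift_coef j c : mi -> V := fun m => (ratio R (mdeg m) j m)%:C%C *: c (inc j m).

(** No Cauchy-Schwarz enters here: the energy at n is distributed over its predecessors in the
    proportions [ratio], which sum to 1. Hence an equality. *)
Lemma lev_bshift c N : \sum_j lev (bshift_coef j c) N = lev c N.+1.
Proof.
rewrite /lev.
transitivity (\sum_(n <- level d N.+1) \sum_(j | (0 < n j)%N)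
     wt R N.+1 n * sqn (c n) * ratio R N j (dec j n)).
  rewrite sum_level_inc; apply: eq_bigr => j _; apply: eq_big_seq => m.
  by rewrite mem_level => /eqP hm; rewrite /bshift_coef sqnZr incK wt_inc hm; ring.
apply: eq_big_seq => n; rewrite mem_level => /eqP hn.
by rewrite -mulr_sumr sum_ratio // mulr1.
Qed.

Lemma sum_row_bshift c n : (0 < mdeg n)%N ->
  \sum_(j | (0 < n j)%N) bshift_coef j c (dec j n) = c n.
Proof.
case E: (mdeg n) => [//|N] _.
rewrite (eq_bigr (fun j => (ratio R N j (dec j n))%:C%C *: c n)); last first.
  by move=> j hj; rewrite /bshift_coef decK //; have := mdeg_dec hj; rewrite E => -[->].
rewrite -scaler_suml -(big_morph _ (raddfD (real_complex R)) (raddf0 (real_complex R))).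
by rewrite sum_ratio // scale1r.
Qed.

Lemma DAipS c c' M : DAip inner c c' M.+1 =
  DAip inner c c' M + \sum_(n <- level d M) (wt R M n)%:C%C * inner (c n) (c' n).
Proof.
rewrite /DAip big_ord_recr; congr (_ + _); apply: eq_bigr => n _.
by rewrite /wt natCr natCV -rmorphM.
Qed.

Lemma DAipE c c' M : DAip inner c c' M =
  \sum_(N < M) \sum_(n <- level d N) (wt R N n)%:C%C * inner (c n) (c' n).
Proof.
elim: M => [|M IH]; first by rewrite /DAip !big_ord0.
by rewrite DAipS IH big_ord_recr.
Qed.

Lemma DAipDl a c c' z M :
  DAip inner (fun n => a *: c n + c' n) z M = a * DAip inner c z M + DAip inner c' z M.
Proof.
rewrite !DAipE mulr_sumr -big_split; apply: eq_bigr => N _.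
rewrite mulr_sumr -big_split; apply: eq_bigr => n _ /=; rewrite innerDl; ring.
Qed.

Lemma DAipC c c' M : DAip inner c' c M = (DAip inner c c' M)^*%C.
Proof.
rewrite !DAipE (big_morph _ (@conjcD R) (conjc0 R)); apply: eq_bigr => N _.
rewrite (big_morph _ (@conjcD R) (conjc0 R)); apply: eq_bigr => n _.
by rewrite conjcM conjc_real -innerC.
Qed.

Lemma DAip_self c M : DAip inner c c M = (DAsq inner c M)%:C%C.
Proof.
rewrite DAipE DAsqE raddf_sum; apply: eq_bigr => N _; rewrite /lev raddf_sum.
by apply: eq_bigr => n _; rewrite innerE -rmorphM.
Qed.

Lemma Re_DAip c c' M : complex.Re (DAip inner c c' M) =
  4^-1 * (DAsq inner (fun n => c n + c' n) M - DAsq inner (fun n => c n - c' n) M).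
Proof.
rewrite DAipE !DAsqE -sumrB Re_sum mulr_sumr; apply: eq_bigr => N _.
rewrite Re_sum /lev -sumrB mulr_sumr; apply: eq_bigr => n _.
rewrite ReZ polarization; ring.
Qed.

Lemma Im_DAip c c' M : complex.Im (DAip inner c c' M) =
  complex.Re (DAip inner c (fun n => ('i%C : R[i]) *: c' n) M).
Proof.
rewrite !DAipE Re_sum Im_sum; apply: eq_bigr => N _.
rewrite Re_sum Im_sum; apply: eq_bigr => n _.
rewrite ReZ ImZ innerZr; congr (_ * _).
by case: (inner _ _) => a b /=; ring.
Qed.

Lemma DAsq_lin a c c' M : DAsq inner (fun n => a *: c n + c' n) M <=
  2 * csq a * DAsq inner c M + 2 * DAsq inner c' M.
Proof.
rewrite !DAsqE !mulr_sumr -big_split; apply: ler_sum => N _.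
rewrite /lev !mulr_sumr -big_split; apply: ler_sum => n _ /=.
rewrite [2 * csq a * _]mulrCA [2 * (_ * _)]mulrCA -mulrDr ler_wpM2l ?wt_ge0 //.
have := sqn_ge0 (a *: c n - c' n); rewrite sqnB sqnD sqnZ; nra.
Qed.

End Levels.

Section DASpace.
Variables (R : realType) (d : nat) (V : hilbType R).
Local Notation mi := {ffun 'I_d -> nat}.

(** Bounded partial sums are equivalent to convergent ones by monotonicity, and are easier to show
    stable under linear combinations. *)
Definition DAp : {pred (mi -> V)} :=
  fun c => `[< exists K, forall M, DAsq inner c M <= K >].

Lemma DApP c : reflect (exists K, forall M, DAsq inner c M <= K) (c \in DAp).
Proof. exact: asboolP. Qed.

Lemma DAp_submod : GRing.submod_closed DAp.
Proof.
split=> [|a x y /DApP[K hK] /DApP[L hL]]; apply/DApP.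
  exists 0 => M; rewrite DAsqE big1 // => N _; rewrite /lev big1 // => n _.
  by rewrite sqn0 mulr0.
exists (2 * csq a * K + 2 * L) => M; apply: le_trans (DAsq_lin _ _ _ _) _.
by rewrite lerD ?ler_wpM2l ?mulr_ge0 ?csq_ge0.
Qed.
HB.instance Definition _ := GRing.isSubmodClosed.Build R[i] (mi -> V) DAp DAp_submod.

Record DA := MkDA { coef :> mi -> V; coefP : coef \in DAp }.
HB.instance Definition _ := [isSub for coef].
HB.instance Definition _ := [Choice of DA by <:].
HB.instance Definition _ := [SubChoice_isSubLmodule of DA by <:].

Implicit Types c : DA.

Lemma daD c c' n : (c + c') n = c n + c' n. Proof. by []. Qed.
Lemma coef_ext c c' : (forall n, c n = c' n) -> c = c'.
Proof. by move=> h; apply/val_inj/funext. Qed.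

Lemma DAsq_cvg c : exists L, [/\ rconv (DAsq inner c) L, (forall M, DAsq inner c M <= L)
  & forall K, (forall M, DAsq inner c M <= K) -> L <= K].
Proof.
have /DApP[K hK] := coefP c.
have [l [cl hl _]] := nondec_conv (@DAsq_nondec _ _ _ c) hK.
exists l; split=> // K' hK'; exact: rconv_le hK' cl (rconv_cst _).
Qed.

Lemma DAip_cvg c c' : exists l, cconv (DAip inner c c') l.
Proof.
(* By polarization the real part is a difference of two monotone bounded sums; the imaginary part is
   the real part for i times the second argument. *)
have re (x y : DA) : exists l, rconv (fun M => complex.Re (DAip inner x y M)) l.
  have [a [ca _ _]] := DAsq_cvg (x + y); have [b [cb _ _]] := DAsq_cvg (x - y).
  exists (4^-1 * (a - b)); apply: rconv_ext (rconvZ _ (rconvB ca cb)) => M.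
  by rewrite Re_DAip.
have [a ca] := re c c'; have [b cb] := re c (('i%C : R[i]) *: c').
exists (a +i* b)%C; apply/cconvP; split=> //=.
by apply: rconv_ext cb => M; rewrite Im_DAip.
Qed.

Definition ip_DA c c' : R[i] := projT1 (cid (DAip_cvg c c')).

Lemma ip_DAP c c' : cconv (DAip inner c c') (ip_DA c c').
Proof. by rewrite /ip_DA; case: cid. Qed.

Lemma ip_DADl a c c' z : ip_DA (a *: c + c') z = a * ip_DA c z + ip_DA c' z.
Proof.
apply: cconv_uniq (ip_DAP _ _) _.
apply: cconv_ext (cconv_lin a (ip_DAP c z) (ip_DAP c' z)) => M.
by rewrite -DAipDl.
Qed.

Lemma ip_DAC c c' : ip_DA c' c = (ip_DA c c')^*%C.
Proof.
apply: cconv_uniq (ip_DAP _ _) _; apply: cconv_ext (cconv_conj (ip_DAP c c')) => M.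
by rewrite -DAipC.
Qed.

Lemma ip_DA_sq c : rconv (DAsq inner c) (complex.Re (ip_DA c c)) /\ complex.Im (ip_DA c c) = 0.
Proof.
have /cconvP[a b] := ip_DAP c c; split.
  by apply: rconv_ext a => M; rewrite DAip_self.
by apply: rconv_uniq b _; apply: rconv_ext (rconv_cst 0) => M; rewrite DAip_self.
Qed.

Lemma DAsq_le_ip c M : DAsq inner c M <= complex.Re (ip_DA c c).
Proof.
have [cv _] := ip_DA_sq c; have [L [cL h _]] := DAsq_cvg c.
by rewrite (rconv_uniq cv cL).
Qed.

Lemma ip_le_DAsq c K : (forall M, DAsq inner c M <= K) -> complex.Re (ip_DA c c) <= K.
Proof.
have [cv _] := ip_DA_sq c; have [L [cL _ h]] := DAsq_cvg c.
by rewrite (rconv_uniq cv cL); apply: h.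
Qed.

Lemma ip_DA_ge0 c : 0 <= ip_DA c c.
Proof.
have [_ h] := ip_DA_sq c; rewrite lecE h eqxx /=.
by apply: le_trans (DAsq_le_ip c 0); rewrite DAsqE big_ord0.
Qed.

Lemma coef_le_ip c n : wt R (mdeg n) n * sqn (c n) <= complex.Re (ip_DA c c).
Proof.
apply: le_trans (coef_le_lev c n) _; apply: le_trans (lev_le_DAsq _ _) _.
exact: DAsq_le_ip.
Qed.

Lemma ip_DA_eq0 c : ip_DA c c = 0 -> c = 0.
Proof.
move=> h; apply: coef_ext => n; apply: sqn_eq0; apply/eqP; rewrite eq_le sqn_ge0 andbT.
by have := coef_le_ip c n; rewrite h pmulr_rle0 // wt_gt0.
Qed.

Lemma ip_DA_complete (u : nat -> DA) : vcauchy ip_DA u -> exists l, vconv ip_DA u l.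
Proof.
move=> cu.
have cc n : vcauchy inner (fun k => u k n).
  move=> e e0; have w0 := wt_gt0 R (mdeg n) n.
  have [|M HM] := cu (Num.sqrt (wt R (mdeg n) n) * e).
    by rewrite mulr_gt0 // sqrtr_gt0.
  exists M => k m h1 h2; have H := HM k m h1 h2.
  rewrite -(ltr_pM2l (x := Num.sqrt (wt R (mdeg n) n))) ?sqrtr_gt0 //.
  apply: le_lt_trans H; rewrite /ipnorm -sqrtrM ?wt_ge0 // ler_sqrt.
    exact: (coef_le_ip (u k - u m) n).
  by have := ip_DA_ge0 (u k - u m); rewrite lecE => /andP[].
have [x cx] := choice (fun n => inner_complete _ (cc n)).
(* Fatou's argument: with the truncation degree M fixed only finitely many coefficients occur, so
   the second index of the Cauchy condition may go to infinity. *)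
have bound e : 0 < e -> exists K, forall k, (K <= k)%N ->
    forall M, DAsq inner (fun n => u k n - x n) M <= e ^+ 2.
  move=> e0; have [K HK] := cu e e0; exists K => k hk M.
  have cv : rconv (fun m => DAsq inner (fun n => u k n - u (m + K)%N n) M)
      (DAsq inner (fun n => u k n - x n) M).
    rewrite DAsqE; apply: rconv_ext (fun m => esym (DAsqE _ _)) _.
    apply: rconv_sum => N; apply: rconv_sum => n; apply: rconvZ.
    have := rconv_sqn (vconv_shift K (cx n)) (u k n); rewrite sqnBC.
    by apply: rconv_ext => m; rewrite sqnBC.
  apply: rconv_le cv (rconv_cst _) => m.
  apply: le_trans (DAsq_le_ip (u k - u (m + K)%N) M) _.
  have := HK k (m + K)%N hk (leq_addl _ _); rewrite /ipnorm => h.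
  have r0 : 0 <= complex.Re (ip_DA (u k - u (m + K)%N) (u k - u (m + K)%N)).
    by have := ip_DA_ge0 (u k - u (m + K)%N); rewrite lecE => /andP[].
  by rewrite -(sqr_sqrtr r0) ler_sqr ?nnegrE ?sqrtr_ge0 ?ltW.
have hx : x \in DAp.
  have [K HK] := bound 1 ltr01.
  rewrite (_ : x = (u K : mi -> V) - (fun n => u K n - x n)).
    apply: rpredB; first exact: coefP.
    by apply/DApP; exists (1 ^+ 2); apply: HK.
  by apply/funext => n /=; rewrite !fctE opprB addrC subrK.
exists (MkDA hx) => e e0; have e2 : 0 < e / 2 by rewrite divr_gt0.
have [K HK] := bound _ e2; exists K => m /HK h; rewrite /ipnorm.
apply: (@le_lt_trans _ _ (e / 2)); last by rewrite ltr_pdivrMr // ltr_pMr // ltr1n.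
rewrite -[leRHS]ger0_norm ?(ltW e2) // -sqrtr_sqr ler_sqrt ?sqr_ge0 //.
exact: (@ip_le_DAsq (u m - MkDA hx)).
Qed.

HB.instance Definition _ := Lmodule_isHilbert.Build R DA
  ip_DADl ip_DAC ip_DA_ge0 ip_DA_eq0 ip_DA_complete.

Lemma DAip_inner c c' : cconv (DAip inner c c') (inner c c').
Proof. exact: ip_DAP. Qed.
Lemma DAsq_sqn c : rconv (DAsq inner c) (sqn c).
Proof. by case: (ip_DA_sq c). Qed.
Lemma DAsq_le c M : DAsq inner c M <= sqn c.
Proof. exact: DAsq_le_ip. Qed.
Lemma sqn_le_DAsq c K : (forall M, DAsq inner c M <= K) -> sqn c <= K.
Proof. exact: ip_le_DAsq. Qed.
Lemma lev_le c N : lev c N <= sqn c.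
Proof. by apply: le_trans (lev_le_DAsq _ _) _; apply: DAsq_le. Qed.

Lemma DA_exists (c : mi -> V) K : (forall M, DAsq inner c M <= K) ->
  exists c' : DA, coef c' = c /\ sqn c' <= K.
Proof.
move=> h; have hc : c \in DAp by apply/DApP; exists K.
by exists (MkDA hc); split=> //; apply: sqn_le_DAsq.
Qed.

End DASpace.

(** * Evaluation on the ball *)

Section Taylor.
Variables (R : realType) (d : nat) (V : hilbType R).
Local Notation mi := {ffun 'I_d -> nat}.
Local Notation nrm := (ipnorm inner).
Implicit Types (c : mi -> V) (n m : mi) (j : 'I_d) (l : 'I_d -> R[i]).

Definition homog l c N : V := \sum_(n <- level d N) mono l n *: c n.

Lemma homog0 l c : homog l c 0 = c mi0.
Proof. by rewrite /homog level0 big_seq1 mono0 scale1r. Qed.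

Lemma eq_homog l c c' N : (forall n, mdeg n = N -> c n = c' n) -> homog l c N = homog l c' N.
Proof. by move=> h; apply: eq_big_seq => n; rewrite mem_level => /eqP /h ->. Qed.

Lemma homog_row l (w : 'I_d -> mi -> V) N :
  homog l (fun n => \sum_(j | (0 < n j)%N) w j (dec j n)) N.+1 = \sum_j l j *: homog l (w j) N.
Proof.
rewrite /homog; transitivity (\sum_(n <- level d N.+1) \sum_(j | (0 < n j)%N)
    mono l n *: w j (dec j n)).
  by apply: eq_bigr => n _; rewrite scaler_sumr.
rewrite sum_level_inc; apply: eq_bigr => j _; rewrite scaler_sumr.
by apply: eq_bigr => m _; rewrite incK mono_inc scalerA.
Qed.

Lemma homog_le l c N : sqn (homog l c N) <= sqmod l ^+ N * lev c N.
Proof.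
rewrite -multinomial; apply: sqn_sum_le => n.
- by rewrite divr_ge0 ?csq_ge0 ?wt_ge0.
- by rewrite mulr_ge0 ?sqn_ge0 ?wt_ge0.
by rewrite sqnZ mulrA divfK // gt_eqF ?wt_gt0.
Qed.

Lemma geom_sum_le (q : R) M : 0 <= q -> q < 1 -> \sum_(N < M) q ^+ N <= (1 - q)^-1.
Proof.
move=> q0 q1; have p : 0 < 1 - q by rewrite subr_gt0.
rewrite -(ler_pM2l p) divff ?gt_eqF //.
have := subrX1 q M; have := exprn_ge0 M q0.
set s := \sum_(N < M) _; lra.
Qed.

Lemma vseries_cvg (v : nat -> V) (a : nat -> R) K :
  (forall N, nrm (v N) <= a N) -> (forall M, \sum_(N < M) a N <= K) ->
  exists x, vconv inner (fun M => \sum_(N < M) v N) x.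
Proof.
move=> h; apply: vcauchy_dominated => m n /subnK <-.
elim: (n - m)%N => [|k IH]; first by rewrite !subrr ipnorm0.
rewrite addSn !big_ord_recr /= addrAC [X in _ <= X]addrAC.
by apply: le_trans (ipnormD _ _) _; rewrite lerD.
Qed.

(** Degree N contributes at most sqmod(l)^(N/2) times the square root of K, a geometric majorant.
    Levels are only assumed bounded, not summable, since the state of a system need not lie in
    [DA]. *)
Lemma taylor_cvg c K l : (forall N, lev c N <= K) -> inball l ->
  exists x, vconv inner (fun M => \sum_(N < M) homog l c N) x.
Proof.
move=> hK /inballE hl; set q := Num.sqrt (sqmod l); set k := Num.sqrt K.
have q1 : q < 1 by rewrite -[X in _ < X]sqrtr1 ltr_sqrt.
have q0 : 0 <= q by rewrite sqrtr_ge0.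
have p : 0 < 1 - q by rewrite subr_gt0.
apply: (@vseries_cvg _ (fun N => q ^+ N * k) ((1 - q)^-1 * k)) => N.
  rewrite ipnorm_le ?mulr_ge0 ?exprn_ge0 ?sqrtr_ge0 //; apply: le_trans (homog_le _ _ _) _.
  have K0 : 0 <= K by apply: le_trans (hK 0%N); apply: lev_ge0.
  rewrite exprMn -exprM mulnC exprM !sqr_sqrtr ?sqmod_ge0 //.
  by rewrite ler_wpM2l // exprn_ge0 // sqmod_ge0.
by rewrite -mulr_suml ler_wpM2r ?sqrtr_ge0 // geom_sum_le.
Qed.

End Taylor.

Section Evaluation.
Variables (R : realType) (d : nat) (V : hilbType R).
Local Notation mi := {ffun 'I_d -> nat}.
Local Notation nrm := (ipnorm inner).
Implicit Types (c : DA d V) (l : 'I_d -> R[i]).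

Lemma ev_exists c l : exists x : V,
  inball l -> vconv inner (fun M => \sum_(N < M) homog l c N) x.
Proof.
case: (pselect (inball l)) => [h|h]; last by exists 0.
by have [x cx] := taylor_cvg (lev_le c) h; exists x.
Qed.

(** Outside the ball [ev_exists] constrains nothing, and the value is unspecified. *)
Definition ev c l : V := projT1 (cid (ev_exists c l)).

Lemma evP c : taylor inner c (ev c).
Proof. by move=> l; rewrite /ev; case: cid. Qed.

Lemma ev_cvg c l : inball l -> vconv inner (fun M => \sum_(N < M) homog l c N) (ev c l).
Proof. exact: evP. Qed.

Lemma taylor_ev c f l : taylor inner c f -> inball l -> f l = ev c l.
Proof. by move=> h hl; apply: vconv_uniq (h l hl) (evP c hl). Qed.

Lemma ev_lin l : inball l -> lin (fun c => ev c l).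
Proof.
move=> hl a c c'; apply: vconv_uniq (evP _ hl) _.
apply: vconv_ext (vconvD (vconvZ a (evP c hl)) (evP c' hl)) => M.
rewrite scaler_sumr -big_split; apply: eq_bigr => N _ /=.
rewrite scaler_sumr -big_split; apply: eq_bigr => n _.
by rewrite -[RHS]/(mono l n *: (a *: c n + c' n)) scalerDr !scalerA mulrC.
Qed.

(** The constant term is minus the sum of the others, which is at most k t/(1-t) <= 2 k t for t <=
    1/2; then t tends to 0. *)
Lemma power_series_head (k : R) (v : nat -> V) : 0 <= k -> (forall i, nrm (v i) <= k) ->
  (forall t : R, 0 < t -> t <= 2^-1 ->
     vconv inner (fun M => \sum_(i < M) (t ^+ i)%:C%C *: v i) 0) ->
  v 0%N = 0.
Proof.
move=> k0 hv hs.
suff h (t : R) : 0 < t -> t <= 2^-1 -> nrm (v 0%N) <= 2 * k * t.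
  apply: sqn_eq0; rewrite -ipnorm_sqr; apply/eqP; rewrite sqrf_eq0 eq_le ipnorm_ge0 andbT.
  have cv := rconvZ (2 * k) (rconv_shift 1 (@rconv_inv R)); rewrite mulr0 in cv.
  apply: rconv_le (rconv_cst (nrm (v 0%N))) cv => n; apply: h; first by rewrite invr_gt0.
  by rewrite lef_pV2 ?posrE // ler_nat addn1.
move=> t0 t1; have cv := rconvD (rconv_shift 1 (proj1 (vconvP _ _) (hs t t0 t1)))
  (rconv_cst (2 * k * t)).
rewrite add0r in cv; apply: rconv_le (rconv_cst (nrm (v 0%N))) cv => M.
rewrite subr0 addn1 big_ord_recl expr0 scale1r.
set r := (X in v 0%N + X).
have hr : nrm r <= 2 * k * t.
  apply: le_trans (ipnorm_sum _ _) _.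
  apply: (@le_trans _ _ (\sum_(i < M) t ^+ i * (t * k))).
    apply: ler_sum => i _; rewrite ipnormZr ?exprn_ge0 ?(ltW t0) // lift0 exprSr.
    by rewrite -mulrA ler_wpM2l ?exprn_ge0 ?(ltW t0) // ler_wpM2l // ltW.
  rewrite -mulr_suml (_ : 2 * k * t = 2 * (t * k)); last by ring.
  rewrite ler_wpM2r ?mulr_ge0 // ?(ltW t0) //; apply: le_trans (geom_sum_le _ (ltW t0) _) _;
    first lra.
  by rewrite -[X in _ <= X]invrK lef_pV2 ?posrE ?invr_gt0 //; lra.
by rewrite -{1}[v 0%N](addrK r); apply: le_trans (ipnormD _ _) _; rewrite lerD2l ipnormN.
Qed.

(* Rescaling l by t turns the homogeneous expansion into a power series in t, whose
   coefficients are recovered one by one. *)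
Lemma power_series_eq0 (k : R) N (v : nat -> V) : 0 <= k -> (forall i, nrm (v i) <= k) ->
  (forall t : R, 0 < t -> t <= 2^-1 ->
     vconv inner (fun M => \sum_(i < M) (t ^+ i)%:C%C *: v i) 0) ->
  v N = 0.
Proof.
move=> k0; elim: N v => [|N IH] v hv hs; first exact: power_series_head k0 hv hs.
have v0 := power_series_head k0 hv hs.
apply: (IH (fun i => v i.+1)) => // t t0 t1.
have := vconvZ (t^-1)%:C%C (vconv_shift 1 (hs t t0 t1)); rewrite scaler0.
apply: vconv_ext => M; rewrite addn1 big_ord_recl v0 scaler0 add0r scaler_sumr.
apply: eq_bigr => i _; rewrite scalerA -rmorphM /= exprS mulrA mulVf ?mul1r //.
by rewrite gt_eqF.
Qed.

End Evaluation.

(** * Uniqueness of Taylor coefficients *)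

Lemma base_repr_inj (b : nat) d (f g : 'I_d -> nat) :
  (forall j, (f j < b)%N) -> (forall j, (g j < b)%N) ->
  (\sum_(j < d) f j * b ^ j = \sum_(j < d) g j * b ^ j)%N -> forall j, f j = g j.
Proof.
elim: d f g => [|d IH] f g hf hg; first by move=> _ [].
have step h : (\sum_(j < d.+1) h j * b ^ j =
    (\sum_(j < d) h (lift ord0 j) * b ^ j) * b + h ord0)%N.
  rewrite big_ord_recl expn0 muln1 addnC big_distrl; congr (_ + _)%N.
  by apply: eq_bigr => j _; rewrite /= -mulnA -expnSr.
have b0 : (0 < b)%N by apply: leq_ltn_trans (hf ord0).
rewrite !step => e.
have e0 : f ord0 = g ord0.
  by have := congr1 (modn^~ b) e; rewrite !modnMDl !modn_small.
have e1 : (\sum_(j < d) f (lift ord0 j) * b ^ j = \sum_(j < d) g (lift ord0 j) * b ^ j)%N.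
  by apply/eqP; rewrite -(eqn_pmul2r b0) -(eqn_add2r (f ord0)) e e0.
move=> j; case: (unliftP ord0 j) => [i ->|->] //.
exact: (IH (fun i => f (lift ord0 i)) (fun i => g (lift ord0 i))).
Qed.

Lemma poly_eq0_of_inv (R : realType) (p : {poly R}) :
  (forall k, p.[(k.+1%:R)^-1] = 0) -> p = 0.
Proof.
move=> h; apply/eqP/negPn/negP => p0.
set rs := [seq (k.+1%:R : R)^-1 | k <- iota 0 (size p)].
have h1 : all (root p) rs by apply/allP => _ /mapP[k _ ->]; apply/rootP.
have h2 : uniq rs.
  rewrite map_inj_uniq ?iota_uniq // => i j /invr_inj /eqP.
  by rewrite eqr_nat eqSS => /eqP.
by have := max_poly_roots p0 h1 h2; rewrite size_map size_iota ltnn.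
Qed.

Section Uniqueness.
Variables (R : realType) (d : nat) (V : hilbType R).
Local Notation mi := {ffun 'I_d -> nat}.
Local Notation nrm := (ipnorm inner).
Implicit Types (l : 'I_d -> R[i]).

Lemma homogeneous_eq0 (c : mi -> V) N :
  (forall l, inball l -> homog l c N = 0) -> forall n, mdeg n = N -> c n = 0.
Proof.
move=> hc n hn; apply: sqn_eq0.
(* Base N+1 exceeds every exponent of degree N, so m is recovered from the digits of [e m]. Pairing
   with [c n] below makes the polynomial real and its coefficient at [e n] equal to |c n|^2. *)
pose e (m : mi) := (\sum_(j < d) m j * N.+1 ^ j)%N.
pose p : {poly R} := \sum_(m <- level d N) (complex.Re (inner (c m) (c n))) *: 'X^(e m).
have e_inj m : m \in level d N -> e m = e n -> m = n.
  rewrite mem_level => /eqP hm /base_repr_inj E; apply/ffunP; apply: E => j.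
    by rewrite ltnS -hm /mdeg (bigD1 j) //= leq_addr.
  by rewrite ltnS -hn /mdeg (bigD1 j) //= leq_addr.
(* Kronecker substitution: distinct monomials of degree N get distinct powers of s *)
have p0 : p = 0.
  apply: poly_eq0_of_inv => k; set s : R := k.+1%:R^-1.
  have s0 : 0 < s by rewrite invr_gt0.
  have s1 : s <= 1 by rewrite invf_le1 // ler1n.
  (* The factor 1/(d+1) keeps the substituted point in the ball: its d squared coordinates are each
     at most 1/(d+1). *)
  pose dl : R := d.+1%:R^-1; have dl0 : 0 < dl by rewrite invr_gt0.
  pose l : 'I_d -> R[i] := fun j => (dl * s ^+ (N.+1 ^ j))%:C%C.
  have hl : inball l.
    apply/inballE; apply: (@le_lt_trans _ _ (\sum_(j < d) dl)).
      apply: ler_sum => j _; rewrite csq_real.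
      have dl1 : dl <= 1 by rewrite invf_le1 // ler1n.
      have h1 : s ^+ (N.+1 ^ j) <= 1 by rewrite exprn_ile1 // ltW.
      have h0 : 0 <= s ^+ (N.+1 ^ j) by rewrite exprn_ge0 // ltW.
      move: (s ^+ _) h0 h1 => q h0 h1.
      have : dl * q <= dl by rewrite ler_piMr // ltW.
      have : 0 <= dl * q by rewrite mulr_ge0 // ltW.
      by move: (dl * q) => r; nra.
    rewrite sumr_const card_ord -mulr_natr mulrC /dl ltr_pdivrMr //.
    by rewrite mul1r ltr_nat.
  have mE m : m \in level d N -> mono l m = (dl ^+ N * s ^+ e m)%:C%C.
    rewrite mem_level => /eqP <-; rewrite /mono /mdeg /e rmorphM /=.
    transitivity (\prod_(j < d) (dl ^+ m j * s ^+ (m j * N.+1 ^ j))%:C%C).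
      apply: eq_bigr => j _; rewrite /l -rmorphXn /= exprMn -exprM.
      by rewrite (mulnC (N.+1 ^ j)%N).
    rewrite -rmorphM -(big_morph _ (rmorphM (real_complex R)) (rmorph1 (real_complex R))).
    by rewrite big_split /= !prodrXr.
  have := congr1 (fun v => complex.Re (inner v (c n))) (hc l hl).
  rewrite inner0l /homog inner_suml Re_sum /= => H.
  have : dl ^+ N * p.[s] = 0.
    rewrite -H /p horner_sum mulr_sumr; apply: eq_big_seq => m hm.
    by rewrite mE // innerZl ReZ hornerZ hornerXn; ring.
  by move/eqP; rewrite mulf_eq0 gt_eqF ?exprn_gt0 //= => /eqP.
have := congr1 (fun q : {poly R} => q`_(e n)) p0; rewrite coef0 /p coef_sum.
rewrite (bigD1_seq n) ?level_uniq ?mem_level ?hn //= coefZ coefXn eqxx mulr1.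
rewrite big_seq_cond big1 ?addr0 // => m /andP[hm mn].
rewrite coefZ coefXn; case: eqVneq => [E|_]; last by rewrite mulr0.
by move: mn; rewrite (e_inj m hm (esym E)) eqxx.
Qed.

Lemma ev_eq0 (c : DA d V) : (forall l, inball l -> ev c l = 0) -> c = 0.
Proof.
move=> h; apply: coef_ext => n; apply: (@homogeneous_eq0 c (mdeg n)) => // l hl.
apply: (@power_series_eq0 _ _ _ (mdeg n) (homog l c) (sqrtr_ge0 (sqn c))) => [i|t t0 t1].
  rewrite ipnorm_le ?sqrtr_ge0 // sqr_sqrtr ?sqn_ge0 //.
  apply: le_trans (homog_le _ _ _) _; apply: le_trans (lev_le c i).
  rewrite ler_piMl ?lev_ge0 // exprn_ile1 ?sqmod_ge0 //.
  by apply/ltW; apply/inballE.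
have hl' : inball (fun j => t%:C%C * l j).
  apply/inballE; apply: le_lt_trans (proj1 (inballE _) hl).
  apply: ler_sum => j _; rewrite csqM csq_real ler_piMl ?csq_ge0 //.
  by rewrite expr_le1 //; lra.
have := evP c hl'; rewrite h //; apply: vconv_ext => M.
apply: eq_bigr => i _; rewrite /homog scaler_sumr; apply: eq_big_seq => m.
rewrite mem_level => /eqP <-; rewrite scalerA; congr (_ *: _).
rewrite /mono /mdeg; under eq_bigr => j _ do rewrite exprMn.
by rewrite big_split /= prodrXr rmorphXn.
Qed.

Lemma ev_inj (c c' : DA d V) : (forall l, inball l -> ev c l = ev c' l) -> c = c'.
Proof.
move=> h; apply/subr0_eq/ev_eq0 => l hl.
by rewrite (linB (ev_lin (V := V) hl)) h // subrr.
Qed.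
End Uniqueness.

(** * Shifts *)

Section Shifts.
Variables (R : realType) (d : nat) (V : hilbType R).
Local Notation mi := {ffun 'I_d -> nat}.
Implicit Types (c : DA d V) (n m : mi) (i j : 'I_d) (l : 'I_d -> R[i]) (v : V).

Definition shift_coef j (c : mi -> V) n : V := if (0 < n j)%N then c (dec j n) else 0.

Lemma shift_coef_inc j (c : mi -> V) n : shift_coef j c (inc j n) = c n.
Proof. by rewrite /shift_coef incE incK. Qed.

Lemma lev_shift j (c : mi -> V) N : lev (shift_coef j c) N.+1 <= lev c N.
Proof.
rewrite /lev (bigID (fun n => (0 < n j)%N)) /= [X in _ + X]big1 ?addr0; last first.
  by move=> n /negPf h; rewrite /shift_coef h sqn0 mulr0.
rewrite sum_level_pos big_seq [X in _ <= X]big_seq; apply: ler_sum => m.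
rewrite mem_level => /eqP hm; rewrite shift_coef_inc wt_inc ler_wpM2r ?sqn_ge0 //.
rewrite ler_piMr ?wt_ge0 // /ratio ler_pdivrMr ?ltr0n // mul1r ler_nat ltnS -hm.
by rewrite /mdeg (bigD1 j) //= leq_addr.
Qed.

Lemma shift_in j c : shift_coef j c \in @DAp R d V.
Proof.
apply/DApP; exists (sqn c) => -[|M]; first by rewrite DAsqE big_ord0 sqn_ge0.
apply: le_trans (DAsq_le c M); rewrite !DAsqE big_ord_recl lev0 /shift_coef ffunE ltnn sqn0 add0r.
by apply: ler_sum => N _; rewrite lift0 lev_shift.
Qed.
Definition shift j c : DA d V := MkDA (shift_in j c).

Lemma bshift_in j c : bshift_coef j c \in @DAp R d V.
Proof.
apply/DApP; exists (sqn c) => M; apply: le_trans (DAsq_le c M.+1).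
rewrite !DAsqE big_ord_recl; apply: (@le_trans _ _ (\sum_(N < M) lev c N.+1)).
  apply: ler_sum => N _; rewrite -lev_bshift (bigD1 j) //= lerDl.
  by apply: sumr_ge0 => i _; apply: lev_ge0.
by rewrite lerDr lev_ge0.
Qed.
Definition bshift j c : DA d V := MkDA (bshift_in j c).

Lemma cst_in v : (fun n : mi => if n == mi0 then v else 0) \in @DAp R d V.
Proof.
apply/DApP; exists (sqn v) => -[|M]; first by rewrite DAsqE big_ord0 sqn_ge0.
rewrite DAsqE big_ord_recl lev0 eqxx big1 ?addr0 // => N _.
rewrite lift0 /lev big_seq big1 // => n; rewrite mem_level => /eqP hn.
by rewrite -mdeg_eq0 hn sqn0 mulr0.
Qed.
Definition cst v : DA d V := MkDA (cst_in v).

Lemma cst0 v : cst v mi0 = v.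
Proof. by rewrite /= eqxx. Qed.
Lemma cst_pos v n : (0 < mdeg n)%N -> cst v n = 0.
Proof. by rewrite lt0n mdeg_eq0 /= => /negPf ->. Qed.

Lemma bshift_lin j : lin (bshift j).
Proof.
move=> a c c'; apply: coef_ext => n /=; rewrite -[RHS]/(a *: bshift_coef j c n + bshift_coef j
  c' n) /bshift_coef.
by rewrite -[X in _ *: X]/(a *: c (inc j n) + c' (inc j n)) scalerDr !scalerA mulrC.
Qed.
Lemma cst_lin : lin cst.
Proof.
move=> a v w; apply: coef_ext => n; rewrite -[RHS]/(a *: cst v n + cst w n) /=.
by case: ifP; rewrite // scaler0 addr0.
Qed.

Lemma bshiftC i j c : bshift i (bshift j c) = bshift j (bshift i c).
Proof.
apply: coef_ext => n; rewrite /= /bshift_coef !scalerA incC !mdeg_inc -!rmorphM /=.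
congr (_%:C%C *: _); rewrite /ratio; case: (eqVneq i j) => [->//|ij].
rewrite !incNE // 1?eq_sym // mulrACA [RHS]mulrACA.
by congr (_ * _); rewrite mulrC.
Qed.

Lemma cconv_shift (u : nat -> R[i]) (z : R[i]) : cconv u z -> cconv (fun k => u k.+1) z.
Proof. by move=> cu e /cu [M HM]; exists M => n h; apply/HM/leqW. Qed.

Lemma shift_adj j : is_adjoint inner inner (shift j) (bshift j).
Proof.
(* The shift raises the degree by one, so its partial sums of length M+1 match those of [bshift] of
   length M. *)
move=> c c'; apply: cconv_uniq (cconv_shift (DAip_inner _ _)) _.
apply: cconv_ext (DAip_inner c (bshift j c')) => M.
rewrite !DAipE big_ord_recl level0 big_seq1 -[coef (shift j c)]/(shift_coef j c) /shift_coef
  ffunE ltnn inner0l mulr0 add0r.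
apply: eq_bigr => N _; rewrite lift0 [RHS](bigID (fun n => (0 < n j)%N)) /=.
rewrite [X in _ = _ + X]big1 ?addr0; last first.
  by move=> n /negPf h; rewrite h inner0l mulr0.
rewrite sum_level_pos; apply: eq_big_seq => m; rewrite mem_level => /eqP hm.
by rewrite incE incK /bshift_coef innerZr conjc_real mulrA -rmorphM /= wt_inc hm.
Qed.

Lemma cst_inner v c : inner (cst v) c = inner v (c mi0).
Proof.
apply: cconv_uniq (cconv_shift (DAip_inner _ _)) _.
have H : cconv (fun=> inner v (c mi0)) (inner v (c mi0)).
  by apply/cconvP; split; apply: rconv_cst.
apply: cconv_ext H => M; rewrite DAipE big_ord_recl level0 big_seq1 cst0 wt0 mul1r.
rewrite big1 ?addr0 // => N _; rewrite big_seq big1 // => n.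
by rewrite mem_level lift0 => /eqP hn; rewrite cst_pos ?hn // inner0l mulr0.
Qed.

(** The Drury-Arveson identity: the products of each shift with its adjoint add up to the identity
    minus the projection onto constants. *)
Lemma DA_decomp c : c = cst (c mi0) + \sum_j shift j (bshift j c).
Proof.
apply: coef_ext => n; rewrite daD.
have -> : coef (\sum_j shift j (bshift j c)) n = \sum_j shift_coef j (bshift_coef j c) n.
  by elim/big_rec2: _ => // j x y _ <-.
case: (posnP (mdeg n)) => [/eqP|n0].
  rewrite mdeg_eq0 => /eqP ->; rewrite cst0 big1 ?addr0 // => j _.
  by rewrite /shift_coef ffunE.
rewrite cst_pos // add0r -{1}(sum_row_bshift c n0) [RHS](bigID (fun j => (0 < n j)%N)) /=.
rewrite [X in _ = _ + X]big1 ?addr0; last by move=> j /negPf; rewrite /shift_coef => ->.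
by apply: eq_bigr => j hj; rewrite /shift_coef hj.
Qed.

Lemma inner_bshift c c' :
  \sum_j inner (bshift j c) (bshift j c') + inner (c mi0) (c' mi0) = inner c c'.
Proof.
rewrite {3}(DA_decomp c) innerD cst_inner inner_suml addrC; congr (_ + _).
by apply: eq_bigr => j _; rewrite shift_adj.
Qed.

Lemma sqn_bshift c : \sum_j sqn (bshift j c) + sqn (c mi0) = sqn c.
Proof. by rewrite /sqn -inner_bshift ReD Re_sum. Qed.

Lemma ev_shift j c l : inball l -> ev (shift j c) l = l j *: ev c l.
Proof.
move=> hl; apply: vconv_uniq (vconv_shift 1 (ev_cvg _ hl)) _.
apply: vconv_ext (vconvZ (l j) (ev_cvg c hl)) => M.
rewrite addn1 big_ord_recl homog0 -[coef (shift j c)]/(shift_coef j c) /shift_coef ffunE ltnn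
  add0r scaler_sumr.
apply: eq_bigr => N _; rewrite lift0 /homog [RHS](bigID (fun n => (0 < n j)%N)) /=.
rewrite [X in _ = _ + X]big1 ?addr0; last first.
  by move=> n /negPf h; rewrite h scaler0.
rewrite sum_level_pos scaler_sumr; apply: eq_bigr => m _.
by rewrite incE incK mono_inc scalerA.
Qed.

Lemma ev_cst v l : inball l -> ev (cst v) l = v.
Proof.
move=> hl; apply: vconv_uniq (vconv_shift 1 (ev_cvg _ hl)) _.
apply: vconv_ext (vconv_cst v) => M.
rewrite addn1 big_ord_recl homog0 cst0 big1 ?addr0 // => N _.
rewrite /homog big_seq big1 // => n; rewrite mem_level lift0 => /eqP hn.
by rewrite cst_pos ?hn // scaler0.
Qed.

Lemma ev_decomp c l : inball l ->
  ev c l = c mi0 + \sum_j l j *: ev (bshift j c) l.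
Proof.
move=> hl; have lE := ev_lin (V := V) hl.
rewrite {1}(DA_decomp c) (linD lE) ev_cst // (lin_sum lE); congr (_ + _).
by apply: eq_bigr => j _; rewrite ev_shift.
Qed.

Definition trunc K (c : mi -> V) n : V := if (mdeg n < K)%N then c n else 0.

Lemma lev_trunc K (c : mi -> V) N : lev (trunc K c) N = if (N < K)%N then lev c N else 0.
Proof.
case: ifP => h; first by apply: eq_lev => n hn; rewrite /trunc hn h.
rewrite /lev big_seq big1 // => n; rewrite mem_level => /eqP hn.
by rewrite /trunc hn h sqn0 mulr0.
Qed.

Lemma DAsq_trunc K (c : mi -> V) M : DAsq inner (trunc K c) M <= DAsq inner c M.
Proof.
by rewrite !DAsqE; apply: ler_sum => N _; rewrite lev_trunc; case: ifP => // _; apply: lev_ge0.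
Qed.

Lemma trunc_in K c : trunc K c \in @DAp R d V.
Proof.
by apply/DApP; exists (sqn c) => M; apply: le_trans (DAsq_trunc _ _ _) (DAsq_le _ _).
Qed.

Lemma trunc_cvg c : vconv inner (fun K => MkDA (trunc_in K c)) c.
Proof.
have cv := rconvB (rconv_cst (sqn c)) (DAsq_sqn c); rewrite subrr in cv.
have nn K : 0 <= sqn c - DAsq inner c K by rewrite subr_ge0 DAsq_le.
apply: vconv_bound (rconv_sqrt0 nn cv) => K.
rewrite ipnormBC ipnormE ler_sqrt //; apply: sqn_le_DAsq => M.
(* The remainder lives in degrees at least K and the sum up to K in the others, so together they fit
   into one partial sum of length maxn M K. *)
rewrite lerBrDr; apply: le_trans (DAsq_le c (maxn M K)).
have e N : lev (c - MkDA (trunc_in K c)) N = if (N < K)%N then 0 else lev c N.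
  rewrite /lev; case: ifP => h; [rewrite big_seq big1 // => n|apply: eq_big_seq => n];
  rewrite mem_level => /eqP hn; rewrite -[coef _ n]/(c n - trunc K c n) /trunc hn h.
    by rewrite subrr sqn0 mulr0.
  by rewrite subr0.
rewrite !DAsqE (eq_bigr _ (fun (N : 'I_M) _ => e N)).
rewrite (big_ord_widen _ (fun N => if (N < K)%N then 0 else lev c N) (leq_maxl M K)).
rewrite (big_ord_widen _ (lev c) (leq_maxr M K)) big_mkcond [X in _ + X]big_mkcond.
rewrite -big_split; apply: ler_sum => N _ /=.
by case: (ltnP N K); case: (ltnP N M); rewrite ?add0r ?addr0 ?lev_ge0.
Qed.

End Shifts.

(** * Operator tuples *)

Section MoreRiesz.
Variable R : realType.
Local Notation nrm := (ipnorm inner).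

(** Representing vectors are limits of values of T. The defect of linearity of L therefore lies in
    the closure of the range of T, and it is orthogonal to that range. *)
Lemma riesz_range_op (H : lmodType R[i]) (E K : hilbType R) (T : H -> K)
    (phi : H -> E -> R[i]) :
  lin T -> (forall e a x y, phi (a *: x + y) e = a * phi x e + phi y e) ->
  (forall h a x y, phi h (a *: x + y) = a^*%C * phi h x + phi h y) ->
  (forall h e, complex.Re (phi h e) <= nrm e * nrm (T h)) ->
  exists L : E -> K, [/\ lin L, forall h e, phi h e = inner (T h) (L e)
    & forall e, sqn (L e) <= sqn e].
Proof.
move=> lT l1 l2 hb.
have [L hL] := choice (fun e => @riesz_range R H K T (phi^~ e) (nrm e) lT (l1 e)
  (ipnorm_ge0 e) (fun h => hb h e)).
have phiL h e : phi h e = inner (T h) (L e) by case: (hL e) => ->.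
exists L; split=> // [a x y|e]; last first.
  by case: (hL e) => _ h _; rewrite -!ipnorm_sqr ler_sqr ?nnegrE ?ipnorm_ge0.
have [_ _ [s1 c1]] := hL (a *: x + y); have [_ _ [s2 c2]] := hL x.
have [_ _ [s3 c3]] := hL y; apply/subr0_eq.
set z := _ - _.
have Tz h : inner (T h) z = 0.
  by rewrite innerBr innerDr innerZr -!phiL l2 subrr.
have := rconv_Re_inner z (vconvB c1 (vconvD (vconvZ a c2) c3)) => cz.
apply: sqn_eq0; apply: rconv_uniq cz _; apply: rconv_ext (rconv_cst 0) => n.
by rewrite innerBl innerD innerZl !Tz mulr0 addr0 subr0.
Qed.

Lemma adjoint_sym (V W : hilbType R) (T : V -> W) (Ts : W -> V) :
  is_adjoint inner inner T Ts -> is_adjoint inner inner Ts T.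
Proof. by move=> ad x y; rewrite innerC -ad -innerC. Qed.

End MoreRiesz.

Section Tuple.
Variables (R : realType) (d : nat) (X : hilbType R) (A : 'I_d -> X -> X).
Local Notation mi := {ffun 'I_d -> nat}.
Local Notation nrm := (ipnorm inner).
Hypothesis linA : forall j, lin (A j).

Section Resolvent.
Hypothesis contrA : forall x, \sum_j sqn (A j x) <= sqn x.

Lemma pencil_le l x : sqn (\sum_j l j *: A j x) <= sqmod l * sqn x.
Proof.
apply: (@le_trans _ _ (sqmod l * \sum_j sqn (A j x))); last by rewrite ler_wpM2l ?sqmod_ge0.
by apply: sqn_sum_le => j; rewrite ?csq_ge0 ?sqn_ge0 // sqnZ.
Qed.

Lemma pencil_lin l : lin (fun x => \sum_j l j *: A j x).
Proof.
move=> a x y; rewrite scaler_sumr -big_split; apply: eq_bigr => j _.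
by rewrite linA scalerDr !scalerA mulrC.
Qed.

(** Neumann series: Z(l)A has norm at most the square root of sqmod(l), which is below 1. *)
Lemma resolvent l v : inball l -> exists x, x - \sum_j l j *: A j x = v.
Proof.
move=> /inballE hl; pose G x := \sum_j l j *: A j x; set q := Num.sqrt (sqmod l).
have q1 : q < 1 by rewrite -[X in _ < X]sqrtr1 ltr_sqrt.
have q0 : 0 <= q by rewrite sqrtr_ge0.
have hG x : nrm (G x) <= q * nrm x.
  rewrite ipnorm_le ?mulr_ge0 ?ipnorm_ge0 // exprMn sqr_sqrtr ?sqmod_ge0 // ipnorm_sqr.
  exact: pencil_le.
have hN N : nrm (iter N G v) <= q ^+ N * nrm v.
  elim: N => [|N IH]; first by rewrite mul1r.
  by rewrite iterS exprS -mulrA; apply: le_trans (hG _) _; rewrite ler_wpM2l.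
have [M|x cx] := @vseries_cvg _ _ (fun N => iter N G v) _ ((1 - q)^-1 * nrm v) hN.
  by rewrite -mulr_suml ler_wpM2r ?ipnorm_ge0 // geom_sum_le.
have bG : bounded inner inner G by exists q.
exists x; apply/eqP; rewrite subr_eq; apply/eqP.
apply: vconv_uniq (vconv_shift 1 cx) _.
apply: vconv_ext (vconvD (vconv_cst v) (bounded_vconv (pencil_lin l) bG cx)) => M.
by rewrite addn1 big_ord_recl (lin_sum (pencil_lin l)).
Qed.

Lemma resolvent_uniq l x y : inball l ->
  x - \sum_j l j *: A j x = y - \sum_j l j *: A j y -> x = y.
Proof.
move=> /inballE hl h; apply/subr0_eq/sqn_eq0; set z := x - y.
have e : z = \sum_j l j *: A j z.
  by apply/subr0_eq; rewrite /z (linB (pencil_lin l)) opprD addrACA -opprD h subrr.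
have := pencil_le l z; rewrite -e; have := sqn_ge0 z; have := sqmod_ge0 l; nra.
Qed.

End Resolvent.

Hypothesis commA : commutative_tuple A.

Lemma iter_comm i j k x : A i (iter k (A j) x) = iter k (A j) (A i x).
Proof. by elim: k => //= k IH; rewrite commA IH. Qed.

Lemma Apow_comm j n x : A j (Apow A n x) = Apow A n (A j x).
Proof.
rewrite /Apow; elim: (enum _) => //= i s IH.
by rewrite iter_comm IH.
Qed.

Lemma Apow_inc j n x : Apow A (inc j n) x = A j (Apow A n x).
Proof.
have notin s : j \notin s -> foldr (fun i y => iter (inc j n i) (A i) y) x s =
    foldr (fun i y => iter (n i) (A i) y) x s.
  elim: s => //= i s IH; rewrite inE negb_or => /andP[ij /IH ->].
  by rewrite incNE // eq_sym.
have := mem_enum 'I_d j; rewrite /Apow; move: (enum_uniq 'I_d).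
elim: (enum _) => //= i s IH /andP[si us]; rewrite inE => /orP[/eqP ji|js].
  by rewrite -ji notin ?incE // ji.
have ij : i != j by apply: contra si => /eqP ->.
by rewrite incNE // IH // iter_comm.
Qed.

Lemma Apow0 x : Apow A mi0 x = x.
Proof. by rewrite /Apow; elim: (enum _) => //= i s ->; rewrite ffunE. Qed.

Definition stab x N : R := \sum_(n <- level d N) (wt R N n)^-1 * sqn (Apow A n x).

Lemma inv_wt N (n : mi) : mdeg n = N.+1 ->
  (wt R N.+1 n)^-1 = \sum_(j | (0 < n j)%N) (wt R N (dec j n))^-1.
Proof.
move=> hn; rewrite -[LHS]mulr1 -(sum_ratio R hn) mulr_sumr; apply: eq_bigr => j hj.
rewrite -{1}(decK hj) wt_inc; have := wt_gt0 R N (dec j n); have := ratio_gt0 R N j (dec j n).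
by move: (wt _ _ _) (ratio _ _ _ _) => a b b0 a0; field; rewrite !gt_eqF.
Qed.

Lemma stab0 x : stab x 0 = sqn x.
Proof. by rewrite /stab level0 big_seq1 wt0 invr1 mul1r Apow0. Qed.

Lemma stabS x N : stab x N.+1 =
  \sum_(m <- level d N) (wt R N m)^-1 * \sum_j sqn (A j (Apow A m x)).
Proof.
rewrite /stab; transitivity (\sum_(n <- level d N.+1) \sum_(j | (0 < n j)%N)
    (wt R N (dec j n))^-1 * sqn (Apow A n x)).
  by apply: eq_big_seq => n; rewrite mem_level => /eqP hn; rewrite (inv_wt hn) mulr_suml.
rewrite sum_level_inc exchange_big; apply: eq_bigr => m _; rewrite mulr_sumr.
by apply: eq_bigr => j _; rewrite incK Apow_inc.
Qed.

(** Isometry of the pair splits the energy of each degree into output and next degree, and the sum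
    telescopes. It is used both ways: stability makes the outputs exhaust |x|^2, and outputs
    exhausting |x|^2 give stability. *)
Lemma stab_energy (Y : hilbType R) (Cc : X -> Y) :
  (forall x, \sum_j sqn (A j x) + sqn (Cc x) = sqn x) ->
  forall x M, \sum_(N < M) \sum_(n <- level d N) (wt R N n)^-1 * sqn (Cc (Apow A n x))
    + stab x M = sqn x.
Proof.
move=> iso x; elim=> [|M IH]; first by rewrite big_ord0 add0r stab0.
rewrite -IH big_ord_recr /= -addrA stabS; congr (_ + _).
rewrite -big_split /stab; apply: eq_bigr => n _ /=.
by rewrite -mulrDr addrC iso.
Qed.

Lemma strongly_stableE : strongly_stable A <-> forall x, rconv (stab x) 0.
Proof.
have e x N : \sum_(n <- level d N) N`!%:R / (mfact n)%:R * ipnorm inner (Apow A n x) ^+ 2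
    = stab x N by apply: eq_bigr => n _; rewrite ipnorm_sqr /wt invf_div.
by split=> h x; apply: rconv_ext (h x) => N; rewrite e.
Qed.

End Tuple.

(** * From an inner multiplier to a realization *)

Section Membership.
Variables (R : realType) (d : nat) (V : hilbType R).

Lemma inDA_DA (f : ('I_d -> R[i]) -> V) c L : inDA inner f c L ->
  exists c' : DA d V, [/\ coef c' = c, sqn c' = L & forall l, inball l -> f l = ev c' l].
Proof.
move=> [ht hL]; have h M : DAsq inner c M <= L.
  apply: rconv_le (rconv_cst _) (rconv_shift M hL) => n.
  by apply: DAsq_nondec; apply: leq_addl.
have [c' [e _]] := DA_exists h; exists c'; split=> //.
  by apply: rconv_uniq (DAsq_sqn c') _; rewrite e.
by move=> l hl; apply: taylor_ev => //; rewrite e.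
Qed.

Lemma DA_inDA (f : ('I_d -> R[i]) -> V) (c : DA d V) :
  (forall l, inball l -> f l = ev c l) -> inDA inner f c (sqn c).
Proof.
move=> h; split; last exact: DAsq_sqn.
by move=> l hl; rewrite h //; apply: evP.
Qed.

End Membership.

Section MultiplicationOperator.
Variables (R : realType) (d : nat) (V W : hilbType R).
Variable S : ('I_d -> R[i]) -> V -> W.

Lemma mult_op : schur inner inner S -> exists M : DA d V -> DA d W,
  [/\ lin M, forall c, sqn (M c) <= sqn c
    & forall c l, inball l -> ev (M c) l = S l (ev c l)].
Proof.
move=> [hS hM].
have ex c : exists g : DA d W, sqn g <= sqn c /\ forall l, inball l -> ev g l = S l (ev c l).
  have [g [L' [hg hL]]] := hM _ _ _ (DA_inDA (fun l (_ : inball l) => erefl (ev c l))).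
  have [g' [_ e1 e2]] := inDA_DA hg; exists g'; rewrite e1; split=> // l hl.
  by rewrite -e2.
have [M hM'] := choice ex; exists M; split=> [a c c'|c|c].
- apply: ev_inj => l hl; have lE := ev_lin (V := W) hl; rewrite lE.
  have [lS _] := hS l hl; rewrite !(proj2 (hM' _)) // (ev_lin (V := V) hl).
  exact: lS.
- exact: (proj1 (hM' c)).
- exact: (proj2 (hM' c)).
Qed.

Lemma mult_op_partial_isometry (M : DA d V -> DA d W) :
  (forall c l, inball l -> ev (M c) l = S l (ev c l)) ->
  (mult_partial_isometry inner inner S <->
   forall c, (forall c', M c' = 0 -> inner c c' = 0) -> sqn (M c) = sqn c).
Proof.
move=> evM; split=> h.
  move=> c hc; have [|g hg] := h _ _ _ (DA_inDA (fun l (_ : inball l) => erefl (ev c l))).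
    move=> f' c' L' /inDA_DA [c'' [<- _ e]] hf.
    rewrite -(hc c''); first exact: DAip_inner.
    apply: ev_eq0 => l hl; rewrite evM // -e // hf //.
  have [g' [_ e1 e2]] := inDA_DA hg; rewrite -e1; congr sqn.
  by apply: ev_inj => l hl; rewrite evM // e2.
move=> f c L /inDA_DA [c' [<- <- e]] hc; exists (M c').
rewrite -(h c'); first by apply: DA_inDA => l hl; rewrite evM // e.
move=> c'' hM; apply: cconv_uniq (DAip_inner _ _) _.
apply: (hc (ev c'') c'' (sqn c'')); first by apply: DA_inDA.
by move=> l hl; rewrite -evM // hM (lin0 (ev_lin (V := W) hl)).
Qed.

End MultiplicationOperator.

(** * The model space and its realization by backward shifts *)

Section FromInner.
Variables (R : realType) (d : nat) (E Y : hilbType R).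
Variables (S : ('I_d -> R[i]) -> E -> Y) (M : DA d E -> DA d Y).
Local Notation nrm := (ipnorm inner).
Hypothesis linS : forall l, inball l -> lin (S l).
Hypothesis linM : lin M.
Hypothesis contrM : forall c, sqn (M c) <= sqn c.
Hypothesis evM : forall c l, inball l -> ev (M c) l = S l (ev c l).
Hypothesis pisoM : forall c, (forall c', M c' = 0 -> inner c c' = 0) -> sqn (M c) = sqn c.
Variable Ms : DA d Y -> DA d E.
Hypothesis adjM : is_adjoint inner inner M Ms.
Hypothesis linMs : lin Ms.

Let adjMs := adjoint_sym adjM.

(** The range of [Ms] is orthogonal to the kernel of M, so M preserves norms there. *)
Lemma adjoint_mult_adjoint g : Ms (M (Ms g)) = Ms g.
Proof.
apply: isometric_adjoint adjM contrM _ _; rewrite pisoM // => c' hc.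
by rewrite adjMs hc inner0r.
Qed.

Lemma Ms_contr g : sqn (Ms g) <= sqn g.
Proof. exact: adjoint_contraction adjM contrM g. Qed.

(** The de Branges-Rovnyak space of S: as M is a partial isometry, I - M Ms is the orthogonal
    projection onto this complement. *)
Definition model := orth (fun h : DA d Y => exists c, h = M c).

Lemma proj_in g : g - M (Ms g) \in orthp (fun h : DA d Y => exists c, h = M c).
Proof.
apply/orthpP => _ [c ->].
by rewrite innerBl -!adjMs adjoint_mult_adjoint subrr.
Qed.
Definition proj g : model := Orth (proj_in g).

Lemma proj_lin : lin proj.
Proof.
move=> a x y; apply: val_inj; rewrite /= linMs linM opprD addrACA.
by rewrite -[RHS]/(a *: (x - M (Ms x)) + (y - M (Ms y))) scalerBr.
Qed.

Lemma Ms_model (x : model) : Ms (oval x) = 0.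
Proof.
apply: inner_ext => z; rewrite -adjM inner0r innerC.
by have /orthpP -> := ovalP x; rewrite ?conjc0 //; exists z.
Qed.

Lemma model_perp (x : model) c : inner (oval x) (M c) = 0.
Proof. by rewrite -adjMs Ms_model inner0l. Qed.

Lemma proj_inner g (x : model) : inner (proj g) x = inner g (oval x).
Proof. by rewrite inner_orth /= innerBl innerC [inner (M _) _]innerC model_perp conjc0 subr0
  -innerC. Qed.

Lemma sqn_proj g : sqn (proj g) = sqn g - sqn (Ms g).
Proof.
rewrite sqn_orth /= sqnB.
have -> : sqn (M (Ms g)) = sqn (Ms g) by rewrite /sqn adjM adjoint_mult_adjoint.
by rewrite Re_innerC adjM -/(sqn (Ms g)); ring.
Qed.

Lemma M_shift j c : M (shift j c) = shift j (M c).
Proof.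
apply: ev_inj => l hl; rewrite evM // !ev_shift // evM //.
by rewrite (linZ (linS hl)).
Qed.

Lemma Ms_bshift j g : Ms (bshift j g) = bshift j (Ms g).
Proof.
apply: inner_ext => z.
by rewrite -adjM -[LHS]shift_adj -M_shift adjM -[RHS]shift_adj.
Qed.

Definition modelA j (x : model) : model := proj (bshift j (oval x)).
Definition modelC (x : model) : Y := oval x mi0.

(** Elements of the model are killed by [Ms], which commutes with the backward shifts. The model is
    thus invariant under them, and the projection in [modelA] acts as the identity. *)
Lemma oval_modelA j x : oval (modelA j x) = bshift j (oval x).
Proof.
by rewrite /modelA /= Ms_bshift Ms_model (lin0 (bshift_lin j)) (lin0 linM) subr0.
Qed.

Lemma modelA_lin j : lin (modelA j).
Proof. by move=> a x y; rewrite /modelA -proj_lin -bshift_lin. Qed.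

Lemma modelC_lin : lin modelC.
Proof. by []. Qed.

Lemma modelA_comm : commutative_tuple modelA.
Proof. by move=> i j x; apply: val_inj; rewrite -![\val _]/(oval _) !oval_modelA bshiftC. Qed.

Lemma model_inner x y :
  \sum_j inner (modelA j x) (modelA j y) + inner (modelC x) (modelC y) = inner x y.
Proof.
rewrite [RHS]inner_orth -inner_bshift; congr (_ + _); apply: eq_bigr => j _.
by rewrite inner_orth !oval_modelA.
Qed.

Lemma model_sqn x : \sum_j sqn (modelA j x) + sqn (modelC x) = sqn x.
Proof. by rewrite /sqn -model_inner ReD Re_sum. Qed.

Lemma modelA_contr x : \sum_j sqn (modelA j x) <= sqn x.
Proof. by rewrite -model_sqn lerDl sqn_ge0. Qed.

Lemma model_isometric : isometric_pair modelA modelC.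
Proof.
have ex j : exists T : model -> model, is_adjoint inner inner (modelA j) T.
  have [|T [hT _]] := adjoint_exists (modelA_lin j); last by exists T.
  apply: contraction_bounded => x; apply: le_trans (modelA_contr x).
  by rewrite (bigD1 j) //= lerDl sumr_ge0 // => i _; apply: sqn_ge0.
have [As hAs] := choice ex.
have [|Cs [hCs _]] := adjoint_exists modelC_lin.
  apply: contraction_bounded => x; rewrite -model_sqn lerDr sumr_ge0 // => i _.
  exact: sqn_ge0.
exists As, Cs; split=> //; split=> // x; apply: inner_ext => z.
rewrite innerDr inner_sumr -hCs -[RHS]model_inner; congr (_ + _).
by apply: eq_bigr => j _; rewrite -hAs.
Qed.

(** The weight is undone by the inverse weights of the observability series, so the observability
    operator of the model is its inclusion into [DA]. *)
Lemma model_coef n x : modelC (Apow modelA n x) = (wt R (mdeg n) n)%:C%C *: oval x n.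
Proof.
elim/mi_ind: n x => [|j n IH] x; first by rewrite Apow0 mdeg0 wt0 scale1r.
rewrite (Apow_inc modelA_comm) (Apow_comm modelA_comm) IH oval_modelA /= /bshift_coef scalerA
  mdeg_inc wt_inc.
by rewrite -rmorphM.
Qed.

(** By [stab_energy] and [model_coef], [stab x N] is the tail from degree N of the Drury-Arveson
    norm of x. *)
Lemma model_stable : strongly_stable modelA.
Proof.
apply/strongly_stableE => x.
have cv := rconvB (rconv_cst (sqn x)) (DAsq_sqn (oval x)).
rewrite -sqn_orth subrr in cv; apply: rconv_ext cv => N.
rewrite -{1}(stab_energy modelA_comm model_sqn x N) DAsqE.
rewrite [X in X + _ - _](_ : _ = \sum_(N' < N) lev (oval x) N'); first by rewrite addrAC subrr
  add0r.
apply: eq_bigr => N' _; apply: eq_big_seq => n; rewrite mem_level => /eqP hn.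
rewrite model_coef hn sqnZr; have := wt_gt0 R N' n.
by move: (wt _ _ _) => a a0; field; rewrite gt_eqF.
Qed.

Local Notation K := ({ffun 'I_d -> model} * Y)%type.
Definition modelT (h : DA d Y) : K := ([ffun j => proj (bshift j h)], h mi0).

Lemma modelT_lin : lin modelT.
Proof.
move=> a x y; rewrite /modelT -[RHS]/(a *: [ffun j => proj (bshift j x)] + [ffun j => proj
  (bshift j y)],
   a *: x mi0 + y mi0); congr pair.
by apply/ffunP => j; rewrite !ffunE bshift_lin proj_lin.
Qed.

Lemma sqn_modelT h : sqn (modelT h) = sqn h - sqn (Ms h) + sqn (Ms h mi0).
Proof.
rewrite sqn_pair sqn_ffun /= -[sqn h]sqn_bshift -[sqn (Ms h)]sqn_bshift.
rewrite (eq_bigr (fun j => sqn (bshift j h) - sqn (bshift j (Ms h)))); last first.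
  by move=> j _; rewrite ffunE sqn_proj Ms_bshift.
rewrite sumrB; ring.
Qed.

(** A Douglas factorization: h -> (Ms h)_0, the adjoint of e -> M (cst e), is dominated in norm by
    [modelT], hence factors through it. The slack in [sqn_modelT] is |h|^2 - |Ms h|^2. *)
Lemma model_input : exists L : E -> K, [/\ lin L,
  forall h e, inner h (M (cst d e)) = inner (modelT h) (L e) & forall e, sqn (L e) <= sqn e].
Proof.
apply: (@riesz_range_op R _ _ _ modelT (fun h e => inner h (M (cst d e)))).
- exact: modelT_lin.
- by move=> e a x y; rewrite innerDl.
- by move=> h a x y; rewrite cst_lin linM innerDr innerZr.
- move=> h e; rewrite -adjMs Re_innerC cst_inner; apply: le_trans (Re_inner_le _ _) _.
  rewrite ler_wpM2l ?ipnorm_ge0 // !ipnormE ler_sqrt ?sqn_ge0 // sqn_modelT.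
  by rewrite lerDr subr_ge0 Ms_contr.
Qed.

Lemma model_realization (U : hilbType R) (iota : U -> E) :
  lin iota -> (forall u, sqn (iota u) = sqn u) ->
  exists (B : 'I_d -> U -> model) (D : U -> Y),
    realizes modelA B modelC D (fun l u => S l (iota u)) /\ contractive_colligation modelA B
      modelC D.
Proof.
move=> li ni; have [L [lL hL cL]] := model_input.
pose B j u := (L (iota u)).1 j; pose D u := (L (iota u)).2.
(* Dual form of the factorization: M on the constant u is D u + sum_j z_j B_j u, with the B_j u in
   the model. *)
have factor u : M (cst d (iota u)) = cst d (D u) + \sum_j shift j (oval (B j u)).
  apply: inner_ext => z; rewrite hL inner_pair inner_ffun innerDr inner_sumr addrC.
  congr (_ + _).
    by rewrite [RHS]innerC cst_inner -innerC.
  apply: eq_bigr => j _; rewrite ffunE proj_inner.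
  by rewrite [RHS]innerC shift_adj -innerC.
exists B, D; split.
  move=> l hl u; have lE := ev_lin (V := Y) hl.
  have [x hx] := resolvent modelA_lin modelA_contr (\sum_j l j *: B j u) hl.
  exists x; split=> //.
  have := evM (cst d (iota u)) hl; rewrite ev_cst // => <-.
  rewrite factor (linD lE) ev_cst //; congr (_ + _).
  rewrite (lin_sum lE).
  (* Put y = sum_j l_j B_j u, an element of the model; S(l)u - D u is the value of y at l. Since y =
     x - sum_j l_j A_j x, and x(l) = C x + sum_j l_j (A_j x)(l) by [ev_decomp], this value is C
     x. *)
  transitivity (ev (oval (\sum_j l j *: B j u)) l).
    rewrite (lin_sum (@oval_lin _ _ _)) (lin_sum lE); apply: eq_bigr => j _.
    by rewrite (linZ (@oval_lin _ _ _)) (linZ lE) ev_shift.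
  rewrite -hx (linB (@oval_lin _ _ _)) (linB lE) (ev_decomp (oval x) hl).
  rewrite (lin_sum (@oval_lin _ _ _)) (lin_sum lE) -[RHS]addr0 -addrA; congr (_ + _).
  apply/eqP; rewrite subr_eq0; apply/eqP; apply: eq_bigr => j _.
  by rewrite (linZ (@oval_lin _ _ _)) (linZ lE) oval_modelA.
split; first exact: modelA_lin.
split; first by move=> j a x y; rewrite /B li lL !ffunE.
split; first exact: modelC_lin.
split; first by move=> a x y; rewrite /D li lL.
move=> x u; rewrite !ipnorm_sqr.
have -> : \sum_(j < d) ipnorm inner (modelA j x + B j u) ^+ 2 + sqn (modelC x + D u)
   = sqn (modelT (oval x) + L (iota u)).
  rewrite sqn_pair sqn_ffun; congr (_ + _); apply: eq_bigr => j _.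
  by rewrite ipnorm_sqr !ffunE.
(* The cross term is the pairing of x with M (cst (iota u)), which vanishes because x is orthogonal
   to the range of M; contractivity is then Pythagoras. *)
rewrite sqnD -hL model_perp mulr0 addr0 sqn_modelT Ms_model sqn0 subr0.
by rewrite -[coef 0 mi0]/(0 : E) sqn0 addr0 lerD2l -(ni u) cL.
Qed.

End FromInner.

(** * From a realization to an inner multiplier *)

Section System.
Variables (R : realType) (d : nat) (X E Y : hilbType R).
Variables (A : 'I_d -> X -> X) (B : 'I_d -> E -> X) (Cc : X -> Y) (D : E -> Y).
Local Notation mi := {ffun 'I_d -> nat}.
Local Notation nrm := (ipnorm inner).
Hypothesis hA : forall j, lin (A j).
Hypothesis hB : forall j, lin (B j).
Hypothesis hC : lin Cc.
Hypothesis hD : lin D.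

(* coefficients of (I - Z A)^-1 (x0 + Z B f), by recursion on the degree N of n *)
Fixpoint state_rec (f : mi -> E) (x0 : X) N (n : mi) : X :=
  if N is N'.+1 then \sum_(j | (0 < n j)%N) (A j (state_rec f x0 N' (dec j n)) + B j (f (dec j
    n)))
  else x0.
Definition state f x0 n := state_rec f x0 (mdeg n) n.
Definition out f x0 n : Y := Cc (state f x0 n) + D (f n).
Definition next f (xi : mi -> X) j n : X := A j (xi n) + B j (f n).

Lemma state0 f x0 : state f x0 mi0 = x0.
Proof. by rewrite /state mdeg0. Qed.

Lemma stateS f x0 n : (0 < mdeg n)%N ->
  state f x0 n = \sum_(j | (0 < n j)%N) next f (state f x0) j (dec j n).
Proof.
rewrite /state; case e: (mdeg n) => [//|N] _ /=; apply: eq_bigr => j hj.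
by have := mdeg_dec hj; rewrite e => -[] ee; rewrite /next ee.
Qed.

Lemma state_uniq f x0 xi : xi mi0 = x0 ->
  (forall n, (0 < mdeg n)%N -> xi n = \sum_(j | (0 < n j)%N) next f xi j (dec j n)) ->
  forall n, state f x0 n = xi n.
Proof.
move=> h0 hS n; have [N] := ubnP (mdeg n); elim: N n => // N IH n; rewrite ltnS => hN.
case: (posnP (mdeg n)) => [/eqP|n0].
  by rewrite mdeg_eq0 => /eqP ->; rewrite state0.
rewrite stateS // hS //; apply: eq_bigr => j hj; rewrite /next IH //.
by rewrite mdeg_dec.
Qed.

Lemma state_lin a f f' x0 x0' n :
  state (fun n => a *: f n + f' n) (a *: x0 + x0') n = a *: state f x0 n + state f' x0' n.
Proof.
move: n; apply: state_uniq => [|n n0]; first by rewrite !state0.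
rewrite !stateS // scaler_sumr -big_split; apply: eq_bigr => j _ /=.
by rewrite /next hA hB !scalerDr addrACA.
Qed.

Section Energy.
Hypothesis contr : forall x e,
  \sum_j sqn (A j x + B j e) + sqn (Cc x + D e) <= sqn x + sqn e.

Lemma lev_state f x0 N : lev (state f x0) N.+1 <= \sum_j lev (next f (state f x0) j) N.
Proof.
rewrite -[leRHS]mulr1; have := lev_row (next f (state f x0)) N; rewrite mulr1.
by congr (_ <= _); apply: eq_lev => n hn; rewrite stateS // hn.
Qed.

Lemma energy f x0 M :
  lev (state f x0) M + DAsq inner (out f x0) M <= sqn x0 + DAsq inner f M.
Proof.
elim: M => [|M IH]; first by rewrite !DAsqE !big_ord0 lev0 state0.
rewrite !DAsqS.
have h : \sum_j lev (next f (state f x0) j) M + lev (out f x0) M <=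
    lev (state f x0) M + lev f M.
  rewrite /lev exchange_big -!big_split; apply: ler_sum => n _ /=.
  by rewrite -mulr_sumr -!mulrDr ler_wpM2l ?wt_ge0 // contr.
have := lev_state f x0 M; move: IH h.
move: (\sum_j _) (lev _ _) (lev _ _) (lev _ _) (lev _ _) (DAsq _ _ _) (DAsq _ _ _) (sqn x0).
by move=> *; lra.
Qed.

Lemma DAsq_out (f : DA d E) x0 M : DAsq inner (out f x0) M <= sqn f + sqn x0.
Proof.
have := energy f x0 M; have := DAsq_le f M; have := lev_ge0 (state f x0) M; lra.
Qed.

Lemma out_in (p : DA d E * X) : out p.1 p.2 \in @DAp R d Y.
Proof. by apply/DApP; exists (sqn p.1 + sqn p.2) => M; apply: DAsq_out. Qed.
(** The operator [M O] of the overview: [response (f, 0)] is multiplication by the transfer function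
    and [response (0, x)] is the observability operator. *)
Definition response (p : DA d E * X) : DA d Y := MkDA (out_in p).

Lemma response_lin : lin response.
Proof.
move=> a [f x] [g y]; apply: coef_ext => n.
rewrite -[RHS]/(a *: out f x n + out g y n) -[LHS]/(out (fun n => a *: f n + g n) (a *: x + y) n).
by rewrite /out state_lin hC hD scalerDr addrACA.
Qed.

Lemma response_contr p : sqn (response p) <= sqn p.
Proof. by rewrite sqn_pair; apply: sqn_le_DAsq => M; apply: DAsq_out. Qed.

Lemma A_contr x : \sum_j sqn (A j x) <= sqn x.
Proof.
have := contr x 0; rewrite sqn0 addr0 (lin0 hD) addr0.
under eq_bigr => j _ do rewrite (lin0 (hB j)) addr0.
by have := sqn_ge0 (Cc x); lra.
Qed.

Lemma A_bounded j : bounded inner inner (A j).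
Proof.
apply: contraction_bounded => x; apply: le_trans (A_contr x).
by rewrite (bigD1 j) //= lerDl sumr_ge0 // => i _; apply: sqn_ge0.
Qed.
Lemma B_bounded j : bounded inner inner (B j).
Proof.
apply: contraction_bounded => e; have := contr 0 e.
rewrite sqn0 add0r (lin0 hC) add0r; apply: le_trans.
rewrite (bigD1 j) //= (lin0 (hA j)) add0r -addrA lerDl addr_ge0 ?sqn_ge0 //.
by apply: sumr_ge0 => i _; apply: sqn_ge0.
Qed.
Lemma C_bounded : bounded inner inner Cc.
Proof.
apply: contraction_bounded => x; have := contr x 0.
rewrite sqn0 addr0 (lin0 hD) addr0; apply: le_trans.
by rewrite lerDr; apply: sumr_ge0 => i _; apply: sqn_ge0.
Qed.
Lemma D_bounded : bounded inner inner D.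
Proof.
apply: contraction_bounded => x; have := contr 0 x.
rewrite sqn0 add0r (lin0 hC) add0r; apply: le_trans.
by rewrite lerDr; apply: sumr_ge0 => i _; apply: sqn_ge0.
Qed.

Lemma homog_lin (V W : hilbType R) (T : V -> W) l (c : mi -> V) N : lin T ->
  T (homog l c N) = homog l (fun n => T (c n)) N.
Proof.
by move=> lT; rewrite /homog (lin_sum lT); apply: eq_bigr => n _; rewrite (linZ lT).
Qed.

Lemma homogD (V : hilbType R) l (c c' : mi -> V) N :
  homog l (fun n => c n + c' n) N = homog l c N + homog l c' N.
Proof. by rewrite /homog -big_split; apply: eq_bigr => n _; rewrite scalerDr. Qed.

Lemma ev_response (f : DA d E) x0 l : inball l -> exists x,
  x = x0 + \sum_j l j *: (A j x + B j (ev f l)) /\ ev (response (f, x0)) l = Cc x + D (ev f l).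
Proof.
(* Only boundedness of the levels of the state is available; it suffices for convergence in the
   ball, where the recursion passes to the limit. *)
move=> hl; have bd N : lev (state f x0) N <= sqn x0 + sqn f.
  apply: le_trans (_ : sqn x0 + DAsq inner f N <= _); last by rewrite lerD2l DAsq_le.
  apply: le_trans (energy f x0 N); rewrite lerDl.
  by rewrite DAsqE sumr_ge0 // => i _; apply: lev_ge0.
have [x cx] := taylor_cvg bd hl; have cf := ev_cvg f hl; exists x; split.
  apply: vconv_uniq (vconv_shift 1 cx) _.
  have cA j := bounded_vconv (hA j) (A_bounded j) cx.
  have cB j := bounded_vconv (hB j) (B_bounded j) cf.
  apply: vconv_ext (vconvD (vconv_cst x0)
    (vconv_sum (index_enum 'I_d) (fun j => vconvZ (l j) (vconvD (cA j) (cB j))))) => M.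
  rewrite addn1 big_ord_recl homog0 state0; congr (_ + _).
  transitivity (\sum_(N < M) \sum_j l j *: homog l (next f (state f x0) j) N).
    rewrite exchange_big; apply: eq_bigr => j _; rewrite -scaler_sumr; congr (_ *: _).
    rewrite (lin_sum (hA j)) (lin_sum (hB j)) -big_split; apply: eq_bigr => N _ /=.
    by rewrite /next homogD (homog_lin _ _ _ (hA j)) (homog_lin _ _ _ (hB j)).
  apply: eq_bigr => N _; rewrite lift0 -homog_row; apply: eq_homog => n hn.
  by rewrite stateS // hn.
apply: vconv_uniq (ev_cvg _ hl) _.
apply: vconv_ext (vconvD (bounded_vconv hC C_bounded cx) (bounded_vconv hD D_bounded cf)) => M.
rewrite (lin_sum hC) (lin_sum hD) -big_split; apply: eq_bigr => N _ /=.
by rewrite (homog_lin _ _ _ hC) (homog_lin _ _ _ hD) -homogD.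
Qed.

Lemma ev_response_realizes S (f : DA d E) l : realizes A B Cc D S -> inball l ->
  ev (response (f, 0)) l = S l (ev f l).
Proof.
move=> hS hl; have [x [hx ->]] := ev_response f 0 hl; have [y [hy ->]] := hS l hl (ev f l).
rewrite addrC; congr (_ + Cc _); apply: (resolvent_uniq hA A_contr hl).
rewrite hy {1}hx add0r; apply/eqP; rewrite subr_eq -big_split; apply/eqP.
by apply: eq_bigr => j _; rewrite scalerDr addrC.
Qed.

Lemma realizes_lin S l : realizes A B Cc D S -> inball l -> lin (S l).
Proof.
move=> hS hl a e e'; have [x [hx ->]] := hS l hl e; have [x' [hx' ->]] := hS l hl e'.
have [y [hy ->]] := hS l hl (a *: e + e').
have -> : y = a *: x + x'.
  apply: (resolvent_uniq hA A_contr hl); rewrite hy (pencil_lin hA).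
  rewrite opprD addrACA -scalerBr hx hx' scaler_sumr -big_split; apply: eq_bigr => j _.
  by rewrite hB scalerDr !scalerA mulrC.
by rewrite hC hD scalerDr addrACA.
Qed.

Lemma realizes_contr S l e : realizes A B Cc D S -> inball l -> sqn (S l e) <= sqn e.
Proof.
move=> hS hl; have [x [hx ->]] := hS l hl e.
have xE : x = \sum_j l j *: (A j x + B j e).
  rewrite (eq_bigr (fun j => l j *: A j x + l j *: B j e)); last by move=> j _; rewrite scalerDr.
  by rewrite big_split -hx /= addrC subrK.
have : sqn x <= sqmod l * \sum_j sqn (A j x + B j e).
  by rewrite {1}xE; apply: sqn_sum_le => j; rewrite ?csq_ge0 ?sqn_ge0 // sqnZ.
have := contr x e; have /inballE := hl; have := sqmod_ge0 l; rewrite [D e + _]addrC.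
have : 0 <= \sum_j sqn (A j x + B j e) by apply: sumr_ge0 => j _; apply: sqn_ge0.
move: (\sum_j _) (sqmod l) (sqn _) (sqn x) (sqn e) => s r a b c; nra.
Qed.

Lemma realizes_schur S : realizes A B Cc D S -> schur inner inner S.
Proof.
move=> hS; split=> [l hl|f c L /inDA_DA [c' [_ <- hf]]].
  split; first exact: realizes_lin.
  by apply: contraction_bounded => e; apply: realizes_contr.
exists (response (c', 0)), (sqn (response (c', 0))); split.
  by apply: DA_inDA => l hl; rewrite hf // (ev_response_realizes _ hS).
by apply: le_trans (response_contr _) _; rewrite sqn_pair sqn0 addr0.
Qed.

(** * Coisometry of [M O]; [Ths] stands for the adjoint of a coisometric colligation *)

Section Coisometry.
Local Notation K := ({ffun 'I_d -> X} * Y)%type.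
Variable Ths : K -> X * E.
Hypothesis Ths0 : Ths 0 = 0.
Hypothesis Ths_iso : forall k, sqn (Ths k) = sqn k.
Hypothesis Ths_inv : forall k : K,
  (forall j, A j (Ths k).1 + B j (Ths k).2 = k.1 j) /\ Cc (Ths k).1 + D (Ths k).2 = k.2.

Section Backward.
Variables (g : DA d Y) (D0 : nat).
Hypothesis gD0 : forall n, (D0 <= mdeg n)%N -> g n = 0.

(* The adjoint system, run from degree D0 (above which g vanishes) down to degree 0. *)
Fixpoint back_rec k (m : mi) : X := if k is k'.+1
  then (Ths ([ffun j => (ratio R (mdeg m) j m)%:C%C *: back_rec k' (inc j m)], g m)).1 else 0.
Definition back m := back_rec (D0 - mdeg m) m.
Definition backK m : K := ([ffun j => bshift_coef j back m], g m).

Lemma back_ge m : (D0 <= mdeg m)%N -> back m = 0.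
Proof. by rewrite /back -subn_eq0 => /eqP ->. Qed.

(** Removes the recursion counter: the fixed-point equation holds in all degrees, since from D0 on
    the state and g vanish and [Ths] maps 0 to 0. *)
Lemma backE m : back m = (Ths (backK m)).1.
Proof.
case: (ltnP (mdeg m) D0) => h; last first.
  rewrite back_ge // (_ : backK m = 0) ?Ths0 //; rewrite /backK gD0 //; congr pair.
  by apply/ffunP => j; rewrite !ffunE /bshift_coef back_ge ?scaler0 // mdeg_inc leqW.
rewrite /back; have e : (D0 - mdeg m)%N = (D0 - (mdeg m).+1).+1 by rewrite subnSK.
rewrite e /=; congr (Ths (_, _)).1; apply/ffunP => j.
by rewrite !ffunE /bshift_coef /back mdeg_inc.
Qed.

Definition back_in m : E := (Ths (backK m)).2.

Lemma back_next j m : next back_in back j m = bshift_coef j back m.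
Proof. by rewrite /next backE (proj1 (Ths_inv _)) ffunE. Qed.

Lemma back_out m : Cc (back m) + D (back_in m) = g m.
Proof. by rewrite backE (proj2 (Ths_inv _)). Qed.

(** The backward trajectory is also a forward one: by [back_next] each step forward restores the
    backward shifts of [back], and these sum back to [back] ([sum_row_bshift]). *)
Lemma back_state m : state back_in (back mi0) m = back m.
Proof.
apply: state_uniq => // n n0; rewrite -{1}(sum_row_bshift back n0).
by apply: eq_bigr => j _; rewrite back_next.
Qed.

Lemma back_lev N : lev back N + lev back_in N = lev back N.+1 + lev g N.
Proof.
rewrite -lev_bshift /lev exchange_big -!big_split; apply: eq_bigr => n _ /=.
rewrite -mulr_sumr -!mulrDr; congr (_ * _).
have := Ths_iso (backK n); rewrite !sqn_pair sqn_ffun /= -backE => ->.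
by congr (_ + _); apply: eq_bigr => j _; rewrite ffunE.
Qed.

Lemma back_energy M : DAsq inner back_in M + sqn (back mi0) = lev back M + DAsq inner g M.
Proof.
elim: M => [|M IH]; first by rewrite !DAsqE !big_ord0 add0r addr0 lev0.
rewrite !DAsqS; have := back_lev M; move: IH.
move: (lev _ _) (lev _ _) (lev _ _) (lev _ _) (DAsq _ _ _) (DAsq _ _ _) (sqn _) => *; lra.
Qed.

Lemma backward : exists p, response p = g /\ sqn p <= sqn g.
Proof.
have bd M : DAsq inner back_in M <= sqn g - sqn (back mi0).
  (* Extending the sum past degree D0 makes the state term of the energy identity vanish. *)
  apply: le_trans (DAsq_nondec back_in (leq_maxl M D0)) _; rewrite lerBrDr back_energy.
  rewrite [X in X + _](_ : _ = 0) ?add0r ?DAsq_le // /lev big_seq big1 // => n.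
  rewrite mem_level => /eqP hn; rewrite back_ge ?sqn0 ?mulr0 // hn.
  exact: leq_maxr.
have [f [ef hf]] := DA_exists bd; exists (f, back mi0); split; last first.
  by rewrite sqn_pair -lerBrDr.
apply: coef_ext => n; rewrite -[LHS]/(out f (back mi0) n) /out ef.
by rewrite back_state back_out.
Qed.

End Backward.

(** It suffices that the adjoint does not shrink norms. If h = response p with |p| <= |h|, then
    |h|^2 is the pairing of p with the adjoint image of h, and Cauchy-Schwarz concludes. Polynomials
    h have such a p, and truncation gives the rest. *)
Lemma response_onto (response_adj : DA d Y -> DA d E * X) :
  is_adjoint inner inner response response_adj -> lin response_adj -> forall g, response
    (response_adj g) = g.
Proof.
move=> ad lP g; have adS := adjoint_sym ad.
have cS := adjoint_contraction ad response_contr.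
apply: (isometric_adjoint adS cS).
have cg := trunc_cvg g; have bS := contraction_bounded cS.
apply: rconv_le (rconv_sqn0 cg) (rconv_sqn0 (bounded_vconv lP bS cg)) => N.
set h := MkDA _; have [|p [hp np]] := @backward h N.
  by move=> n hn; rewrite /= /trunc ltnNge hn.
have := cauchy_schwarz p (response_adj h); rewrite -ad hp -/(sqn h) => H.
have [->|n0] := eqVneq (sqn h) 0; first exact: sqn_ge0.
have h0 : 0 < sqn h by rewrite lt0r n0 sqn_ge0.
rewrite -(ler_pM2l h0) -expr2; apply: le_trans H _.
by rewrite ler_wpM2r ?sqn_ge0.
Qed.

Hypothesis O_iso : forall x, sqn (response (0, x)) = sqn x.

Lemma response_partial_isometry (c : DA d E) :
  (forall c', response (c', 0) = 0 -> inner c c' = 0) -> sqn (response (c, 0)) = sqn c.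
Proof.
move=> hc; apply/eqP; rewrite eq_le; apply/andP; split.
  by apply: le_trans (response_contr _) _; rewrite sqn_pair sqn0 addr0.
have [response_adj [ad lP]] := adjoint_exists response_lin (contraction_bounded response_contr).
set g := response (c, 0); have := response_onto ad lP g.
have := adjoint_contraction ad response_contr g; rewrite sqn_pair.
case: (response_adj g) => f x /= hp hg.
(* Coisometry writes g = M c also as M f + O x, with (f, x) the adjoint image of g, so that M (c -
   f) = O x. *)
have diff : response (c - f, 0) = response (0, x).
  have -> : (c - f, 0) = (c, 0) - (f, 0) :> DA d E * X by congr pair; rewrite subr0.
  have -> : (0, x) = (f, x) - (f, 0) :> DA d E * X by congr pair; rewrite ?subrr ?subr0.
  by rewrite !(linB response_lin) hg.
(* O isometric and [M O] contractive force the ranges of M and O to be orthogonal *)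
have x0 : sqn x = 0.
  apply/eqP; rewrite -oppr_eq0; apply/eqP.
  apply: (@quad_ge0_eq0 _ (sqn (c - f))) (sqn_ge0 _) _ => t.
  have := response_contr (t%:C%C *: (c - f), x); rewrite sqn_pair /= sqnZr.
  have -> : (t%:C%C *: (c - f), x) = t%:C%C *: (c - f, 0) + (0, x) :> DA d E * X.
    by rewrite -[RHS]/(t%:C%C *: (c - f) + 0, t%:C%C *: 0 + x) scaler0 add0r addr0.
  rewrite response_lin diff -{2}[response (0, x)]scale1r -scalerDl -[1]/(1%:C%C) -rmorphD /=.
  rewrite sqnZr O_iso; have := mulr_ge0 (sqr_ge0 t) (sqn_ge0 x).
  move: (sqn x) (sqn (c - f)) => s q; lra.
(* Now c - f lies in the kernel of M, hence is orthogonal to c: |c|^2 is the pairing of c with f, so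
   |c| <= |f| <= |g|. *)
have e0 : inner c (c - f) = 0 by apply: hc; rewrite diff (sqn_eq0 x0) (lin0 response_lin).
have : sqn c = complex.Re (inner c f).
  by move/(congr1 (@complex.Re _)): e0; rewrite innerBr ReD ReN -/(sqn c) /=; lra.
have := cauchy_schwarz c f => H e; rewrite -e in H.
have [->|n0] := eqVneq (sqn c) 0; first exact: sqn_ge0.
have c0 : 0 < sqn c by rewrite lt0r n0 sqn_ge0.
rewrite expr2 ler_pM2l // in H; apply: le_trans H _.
by rewrite x0 addr0 in hp.
Qed.

End Coisometry.

End Energy.
End System.

(** * Isometry of the observability operator *)

Section Observability.
Variables (R : realType) (d : nat) (X E Y : hilbType R).
Variables (A : 'I_d -> X -> X) (B : 'I_d -> E -> X) (Cc : X -> Y) (D : E -> Y).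
Hypothesis hA : forall j, lin (A j).
Hypothesis hB : forall j, lin (B j).
Hypothesis hC : lin Cc.
Hypothesis hD : lin D.
Hypothesis contr : forall x e,
  \sum_j sqn (A j x + B j e) + sqn (Cc x + D e) <= sqn x + sqn e.
Hypothesis commA : commutative_tuple A.
Hypothesis stable : strongly_stable A.
Hypothesis iso : forall x, \sum_j sqn (A j x) + sqn (Cc x) = sqn x.

(** The unforced state at n sums over all lattice paths from 0 to n; by commutativity each path
    contributes the same vector, and the inverse weight counts the paths. *)
Lemma free_state x n :
  state A B (coef 0) x n = ((wt R (mdeg n) n)^-1)%:C%C *: Apow A n x.
Proof.
move: n; apply: state_uniq => [|n n0].
  by rewrite mdeg0 wt0 invr1 scale1r Apow0.
case e: (mdeg n) n0 => [//|N] _.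
rewrite (inv_wt R e) raddf_sum scaler_suml; apply: eq_bigr => j hj.
have := mdeg_dec hj; rewrite e /next => -[->].
rewrite -[coef 0 (dec j n)]/(0 : E) (lin0 (hB j)) addr0 (linZ (hA j)).
by rewrite -(Apow_inc commA) decK.
Qed.

Lemma observability_isometric x : sqn (response contr (0, x)) = sqn x.
Proof.
apply: rconv_uniq (DAsq_sqn _) _.
have cv := proj1 (strongly_stableE A) stable x.
have := rconvB (rconv_cst (sqn x)) cv; rewrite subr0; apply: rconv_ext => M.
rewrite -(stab_energy commA iso x M) addrK DAsqE.
apply: eq_bigr => N _; apply: eq_big_seq => n; rewrite mem_level => /eqP hn.
rewrite -[coef _ n]/(out A B Cc D (coef 0) x n) /out free_state hn.
rewrite -[coef 0 n]/(0 : E) (lin0 hD) addr0 (linZ hC) sqnZr.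
have := wt_gt0 R N n; move: (wt _ _ _) => a a0.
by field; rewrite gt_eqF.
Qed.

End Observability.

Lemma isometric_pair_sqn (R : realType) d (X Y : hilbType R) (A : 'I_d -> X -> X)
  (Cc : X -> Y) : isometric_pair A Cc ->
  forall x, \sum_j sqn (A j x) + sqn (Cc x) = sqn x.
Proof.
move=> [As [Cs [hAs [hCs h]]]] x.
have -> : sqn x = complex.Re (inner x (\sum_j As j (A j x) + Cs (Cc x))) by rewrite h.
rewrite innerDr inner_sumr -hCs ReD Re_sum.
by congr (_ + _); apply: eq_bigr => j _; rewrite -hAs.
Qed.

Section CoisometricExtension.
Variables (R : realType) (d : nat) (X U Y : hilbType R).
Variables (A : 'I_d -> X -> X) (B : 'I_d -> U -> X) (Cc : X -> Y) (D : U -> Y).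
Hypothesis hA : forall j, lin (A j).
Hypothesis hB : forall j, lin (B j).
Hypothesis hC : lin Cc.
Hypothesis hD : lin D.
Hypothesis contr : forall x e,
  \sum_j sqn (A j x + B j e) + sqn (Cc x + D e) <= sqn x + sqn e.
Local Notation K := ({ffun 'I_d -> X} * Y)%type.

Definition colligation (p : X * U) : K :=
  ([ffun j => A j p.1 + B j p.2], Cc p.1 + D p.2).

Lemma colligation_lin : lin colligation.
Proof.
move=> a x y; rewrite /colligation -[RHS]/(a *: [ffun j => A j x.1 + B j x.2]
   + [ffun j => A j y.1 + B j y.2], a *: (Cc x.1 + D x.2) + (Cc y.1 + D y.2)).
congr pair; last by rewrite hC hD scalerDr addrACA.
by apply/ffunP => j; rewrite !ffunE hA hB scalerDr addrACA.
Qed.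

Lemma colligation_contr p : sqn (colligation p) <= sqn p.
Proof.
rewrite !sqn_pair sqn_ffun; apply: le_trans (contr p.1 p.2); rewrite lerD2r.
by rewrite le_eqVlt; apply/orP; left; apply/eqP/eq_bigr => j _; rewrite ffunE.
Qed.

(* Adjoining the defect operator Q = (I - T T* )^(1/2) of T = colligation as an extra
   input column makes [T Q] coisometric: T T* + Q Q = I. *)
Lemma coisometric_extension : exists (Q : K -> K) (Ths : K -> X * (U * K)),
  [/\ lin Q, Ths 0 = 0, (forall k, sqn (Ths k) = sqn k),
      (forall k, colligation ((Ths k).1, (Ths k).2.1) + Q (Ths k).2.2 = k)
    & forall x u k, sqn (colligation (x, u) + Q k) <= sqn x + sqn (u, k)].
Proof.
have [Ts [ad lT]] := adjoint_exists colligation_lin (contraction_bounded colligation_contr).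
have adS := adjoint_sym ad.
have [|||Q [lQ adQ QQ]] := @sqrt_exists R _ (fun k => colligation (Ts k)).
- by move=> a x y; rewrite lT colligation_lin.
- by move=> x y; rewrite ad adS.
- move=> x; apply: le_trans (colligation_contr _) _.
  exact: adjoint_contraction ad colligation_contr x.
pose Ths k : X * (U * K) := ((Ts k).1, ((Ts k).2, Q k)).
pose T' (p : X * (U * K)) : K := colligation (p.1, p.2.1) + Q p.2.2.
have adT : is_adjoint inner inner T' Ths.
  move=> p k; rewrite innerD ad adQ !inner_pair /=; ring.
have inv k : T' (Ths k) = k.
  by rewrite /T' /= QQ -surjective_pairing addrC subrK.
have isoT k : sqn (Ths k) = sqn k.
  by rewrite {1}/sqn -adT inv.
exists Q, Ths; split=> //.
  by rewrite /Ths (lin0 lT) (lin0 lQ).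
move=> x u k; rewrite (_ : _ + sqn (u, k) = sqn (x, (u, k))); last by rewrite [RHS]sqn_pair.
(* Contractivity of the extended colligation needs no computation: it is the adjoint of the isometry
   [Ths]. *)
have cT k' : sqn (Ths k') <= sqn k' by rewrite isoT.
exact: (adjoint_contraction (adjoint_sym adT) cT (x, (u, k))).
Qed.

End CoisometricExtension.

(** * The two implications *)

Lemma inner_of_realization (R : realType) (d : nat) (U Y X : hilbType R)
  (S : ('I_d -> R[i]) -> U -> Y) (A : 'I_d -> X -> X) (B : 'I_d -> U -> X)
  (Cc : X -> Y) (D : U -> Y) :
  realizes A B Cc D S -> contractive_colligation A B Cc D ->
  commutative_tuple A -> strongly_stable A -> isometric_pair A Cc ->
  exists (F : hilbType R) (St : ('I_d -> R[i]) -> F -> Y),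
    inner_multiplier (ip_sum inner inner) inner
      (fun l (p : U * F) => S l p.1 + St l p.2).
Proof.
move=> real [hA [hB [hC [hD hcontr]]]] comm stable /isometric_pair_sqn iso.
have contr x u : \sum_j sqn (A j x + B j u) + sqn (Cc x + D u) <= sqn x + sqn u.
  have := hcontr x u; rewrite !ipnorm_sqr; congr (_ + _ <= _).
  by apply: eq_bigr => j _; rewrite ipnorm_sqr.
have [Q [Ths [lQ Ths0 isoT inv contrT]]] := coisometric_extension hA hB hC hD contr.
pose K := ({ffun 'I_d -> X} * Y)%type.
(* The auxiliary space F is all of X^d + Y, where the defect operator acts; its first component
   feeds the states and its second the output. *)
pose B' j (e : U * K) := B j e.1 + (Q e.2).1 j.
pose D' (e : U * K) := D e.1 + (Q e.2).2.
have hB' j : lin (B' j).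
  by move=> a x y; rewrite /B' hB lQ !ffunE scalerDr addrACA.
have hD' : lin D'.
  by move=> a x y; rewrite /D' hD lQ scalerDr addrACA.
have contr' x (e : U * K) :
    \sum_j sqn (A j x + B' j e) + sqn (Cc x + D' e) <= sqn x + sqn e.
  apply: le_trans (contrT x e.1 e.2); rewrite [leRHS]sqn_pair sqn_ffun /= -addrA lerD //.
  by rewrite le_eqVlt; apply/orP; left; apply/eqP/eq_bigr => j _; rewrite !ffunE addrA.
(* The guard makes the claim true for every l, so that choice applies; [Rs l k] solves the state
   equation driven by Q k alone. *)
have ex l (k : K) : exists x, inball l ->
    x - \sum_j l j *: A j x = \sum_j l j *: (Q k).1 j.
  case: (pselect (inball l)) => [hl|?]; last by exists 0.
  have [x hx] := resolvent hA (A_contr hB hD contr) (\sum_j l j *: (Q k).1 j) hl.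
  by exists x.
pose Rs l k := projT1 (choice (ex l)) k.
have hRs l k : inball l -> Rs l k - \sum_j l j *: A j (Rs l k) = \sum_j l j *: (Q k).1 j.
  exact: (projT2 (choice (ex l)) k).
pose St l k := (Q k).2 + Cc (Rs l k).
have real' : realizes A B' Cc D' (fun l (p : U * K) => S l p.1 + St l p.2).
  move=> l hl [u k]; have [x [hx ->]] := real l hl u; exists (x + Rs l k); split.
    rewrite (linD (pencil_lin hA l)) opprD addrACA hx hRs // -big_split.
    by apply: eq_bigr => j _; rewrite /= -scalerDr.
  by rewrite (linD hC) addrACA.
exists (K : hilbType R), St; split; first exact: realizes_schur hA hB' hC hD' contr' _ real'.
have evM (c : DA d (U * K)%type) l (hl : inball l) :=
  ev_response_realizes hA hB' hC hD' contr' c real' hl.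
apply: (proj2 (mult_op_partial_isometry (M := fun c => response contr' (c, 0)) evM)) => c hc.
apply: (response_partial_isometry hA hB' hC hD' Ths0 isoT) => // [k|x].
  have := inv k; rewrite /colligation [k in _ = k]surjective_pairing => -[e1 e2]; split=> [j|].
    by rewrite -e1 !ffunE /B' addrA.
  by rewrite /D' addrA.
exact: observability_isometric.
Qed.

Lemma realization_of_inner (R : realType) (d : nat) (U F Y : hilbType R)
  (S : ('I_d -> R[i]) -> U -> Y) (St : ('I_d -> R[i]) -> F -> Y) :
  schur inner inner S ->
  inner_multiplier (ip_sum inner inner) inner (fun l (p : U * F) => S l p.1 + St l p.2) ->
  exists (X : hilbType R) (A : 'I_d -> X -> X) (B : 'I_d -> U -> X)
       (Cc : X -> Y) (D : U -> Y),
      realizes A B Cc D S /\ contractive_colligation A B Cc D /\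
      commutative_tuple A /\ strongly_stable A /\ isometric_pair A Cc.
Proof.
move=> [linS _] [schurS pisoS]; set Sh := fun l p => _ in schurS pisoS.
have [M [lM contrM evM]] := @mult_op R d (U * F)%type Y Sh schurS.
have pisoM := proj1 (mult_op_partial_isometry evM) pisoS.
have [Ms [adM lMs]] := adjoint_exists lM (contraction_bounded contrM).
have linSh l : inball l -> lin (Sh l) by move=> hl; case: (proj1 schurS l hl).
(* Realizing along u -> (u, 0) keeps only the columns of the model that belong to S. *)
have li : lin (fun u : U => (u, 0 : F)).
  by move=> a x y; rewrite -[RHS]/(a *: x + y, a *: 0 + 0) scaler0 addr0.
have [u|B [D [real coll]]] :=
    model_realization linSh lM contrM evM pisoM adM lMs li.
  by rewrite sqn_pair /= sqn0 addr0.
exists (model M), (modelA contrM pisoM adM), B, (modelC (M := M)), D; split.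
  move=> l hl u; have [x [hx e]] := real l hl u; exists x; split=> //.
  (* Linearity is known for [S l] and for the whole row, and both vanish at 0; this forces
     [St l 0 = 0]. *)
  rewrite -e /Sh /=; suff -> : St l 0 = 0 by rewrite addr0.
  have := lin0 (linSh l hl); rewrite /Sh /= (lin0 (proj1 (linS l hl))).
  by rewrite add0r.
split=> //; split; first exact: (modelA_comm linSh lM contrM evM pisoM adM).
split; first exact: (model_stable linSh lM contrM evM pisoM adM).
exact: (model_isometric linSh lM contrM evM pisoM adM lMs).
Qed.

Theorem theorem4p4 (R : realType) (d : nat) (U Y : hilbType R)
  (S : ('I_d -> R[i]) -> U -> Y) :
  schur inner inner S ->
  ((exists (X : hilbType R) (A : 'I_d -> X -> X) (B : 'I_d -> U -> X)
       (Cc : X -> Y) (D : U -> Y),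
      realizes A B Cc D S /\ contractive_colligation A B Cc D /\
      commutative_tuple A /\ strongly_stable A /\ isometric_pair A Cc)
   <->
   (exists (F : hilbType R) (St : ('I_d -> R[i]) -> F -> Y),
      inner_multiplier (ip_sum inner inner) inner
        (fun l (p : U * F) => S l p.1 + St l p.2))).
Proof.
move=> hS; split.
  move=> [X [A [B [Cc [D [h1 [h2 [h3 [h4 h5]]]]]]]]].
  exact: inner_of_realization h1 h2 h3 h4 h5.
by move=> [F [St h]]; apply: realization_of_inner hS h.
Qed.
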